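(* Suppose that: (a) there exist a probability measure $\nu$ on $\mathsf{X}$, a constant $\varepsilon>0$ and a set $\mathcal{C}\in\mathcal{X}$ such that for any $\theta\in\Theta$ and $x\in\mathsf{X}$, $P_\theta(x,\cdot)\ge \mathbf{1}_{\mathcal{C}}(x)\,\varepsilon\,\nu(\cdot)$; (b) there exist a measurable function $V:\mathsf{X}\to[1,+\infty)$, $0<\alpha<1$ and positive constants $b,c$ such that, with the same set $\mathcal{C}$, for any $\theta\in\Theta$, $P_\theta V\le V-c\,V^{1-\alpha}+b\,\mathbf{1}_{\mathcal{C}}$; (c) there exist a probability measure $\pi$ on $\mathsf{X}$ and some $0\le\beta<1-\alpha$ such that for any level set $\mathcal{D}=\{x\in\mathsf{X}:V(x)\le d\}$ of $V$, $$\lim_{n\to+\infty}\sup_{(x,\theta)\in\mathcal{D}\times\Theta}\|P_\theta^n(x,\cdot)-\pi\|_{V^\beta}=0;$$ (d) for any level set $\mathcal{D}$ of $V$ and any $\epsilon>0$, $$\lim_{n}\sup_{l\ge 0}\sup_{(x,\theta)\in\mathcal{D}\times\Theta}\mathbb{P}^{(l)}_{x,\theta}\left(D(\theta_n,\theta_{n-1})\ge\epsilon\right)=0 .$$ Then for any measurable function $f:\mathsf{X}\to\mathbb{R}$ with $\sup_{\mathsf{X}}|f|/V^\beta<+\infty$ and any initial distributions $\xi_1,\xi_2$ on $\mathsf{X}$ and $\Theta$ respectively such that $\xi_1(V)<+\infty$, $$\lim_{n\to+\infty}n^{-1}\sum_{k=1}^n f(X_k)=\pi(f),\qquad \mathbb{P}_{\xi_1,\xi_2}\text{-almost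 surely}.$$
   Context: Setting. $(\mathsf{X},\mathcal{X})$ and $(\Theta,\mathcal{B}(\Theta))$ are measurable spaces with countably generated $\sigma$-fields. $\{P_\theta,\theta\in\Theta\}$ is a family of Markov transition kernels on $(\mathsf{X},\mathcal{X})$ such that $\theta\mapsto P_\theta(x,A)$ is measurable for all $(x,A)\in\mathsf{X}\times\mathcal{X}$; $P_\theta^n$ denotes the $n$-th iterate and $P_\theta V(x)=\int P_\theta(x,dy)V(y)$. $\{\bar P(n;\cdot,\cdot),n\ge 0\}$ is a family of transition kernels on $(\mathsf{X}\times\Theta,\mathcal{X}\otimes\mathcal{B}(\Theta))$ satisfying $\int_{A\times\Theta}\bar P(n;(x,\theta);(dx',d\theta'))=P_\theta(x,A)$ for all $n\ge0$, $(x,\theta)\in \mathsf{X}\times\Theta$, $A\in\mathcal{X}$. For an integer $l\ge 0$, $\mathbb{P}^{(l)}_{x,\theta}$ (expectation $\mathbb{E}^{(l)}_{x,\theta}$) is the law on the canonical space of the non-homogeneous Markov chain $\{(X_n,\theta_n),n\ge 0\}$ started at $(x,\theta)$ whose transition kernel from time $n$ to time $n+1$ is $\bar P(l+n;\cdot,\cdot)$. $\mathbb{P}_{\xi_1,\xi_2}$ is the law when $l=0$ and $(X_0,\theta_0)\sim\xi_1\otimes\xi_2$. Notation. For $W:\mathsf{X}\to[1,+\infty)$ and a signed measure $\mu$, $\|\mu\|_W=\sup\{|\mu(g)|:\ \sup_{\mathsf{X}}|g|/W\le 1\}$, and $\|\mu\|_{\mathrm{TV}}=\|\mu\|_1$ (i.e.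 $W\equiv 1$). $D(\theta,\theta')=\sup_{x\in\mathsf{X}}\|P_\theta(x,\cdot)-P_{\theta'}(x,\cdot)\|_{\mathrm{TV}}$. *)

(* Defs.v *)
From HB Require Import structures.
From mathcomp Require Import all_boot all_order all_algebra.
From mathcomp Require Import all_classical all_reals all_analysis.
From mathcomp Require Import measurable_realfun.

Set Implicit Arguments.
Unset Strict Implicit.
Unset Printing Implicit Defensive.
Import Order.TTheory GRing.Theory Num.Theory.
Import numFieldNormedType.Exports.

Local Open Scope classical_set_scope.
Local Open Scope ring_scope.
Local Open Scope ereal_scope.

Definition countably_generated d (T : measurableType d) : Prop :=
  exists2 G : set (set T), countable G & @measurable d T = <<s G >>.

(* Supremum in [0, +oo]: unlike ereal_sup, it is 0 (and not -oo) on the empty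
   set, which matters for empty level sets. *)
Definition sup_ge0 {R : realType} (S : set (\bar R)) : \bar R :=
  ereal_sup (0 |` S).

Section kernels.
Context {R : realType} {d : measure_display} {X : measurableType d}.

Fixpoint kiter (P : R.-pker X ~> X) (n : nat) : R.-spker X ~> X :=
  if n is n'.+1 then mkcomp_noparam P (kiter P n')
  else kdirac (@measurable_id d X setT).

(* || mu - nu ||_W, where (mu - nu)(g) = mu(g) - nu(g). If W is integrable for
   mu but not for nu, then g = W makes this norm +oo. *)
Definition wnorm_sub (W : X -> R) (mu nu : {measure set X -> \bar R}) : \bar R :=
  sup_ge0 [set `| \int[mu]_x (g x)%:E - \int[nu]_x (g x)%:E |
    | g in [set g : X -> R |
             measurable_fun setT g /\ forall x, (`|g x| / W x <= 1)%R]].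

Definition tv_sub (mu nu : {measure set X -> \bar R}) : \bar R :=
  wnorm_sub (cst 1%R) mu nu.

Definition kernel_dist {Theta : Type} (P : Theta -> R.-pker X ~> X)
    (t t' : Theta) : \bar R :=
  sup_ge0 [set tv_sub (P t x) (P t' x) | x in [set: X]].

End kernels.

Section canonical_space.
Context {d : measure_display} (Z : measurableType d).

Definition coord_events (I : set nat) : set (set (nat -> Z)) :=
  \bigcup_(i in I) preimage_set_system setT (fun w : nat -> Z => w i) measurable.

(* Z^nat with its product sigma-algebra. *)
Definition path_space := g_sigma_algebraType (coord_events setT).

(* sigma(Z_0, ..., Z_n) *)
Definition past (n : nat) : set (set (nat -> Z)) :=
  <<s coord_events `I_n.+1 >>.

End canonical_space.

(* Pr is the law on the canonical space of the Markov chain with initial law mu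
   whose transition kernel from time n to time n.+1 is K n: the second clause
   says that Pr(Z_(n+1) \in B | Z_0, ..., Z_n) = K n (Z_n, B) almost surely. By
   the Ionescu-Tulcea theorem there is exactly one such Pr for each probability mu. *)
Definition is_chain_law {R : realType} d (Z : measurableType d)
    (K : nat -> R.-pker Z ~> Z) (mu : {measure set Z -> \bar R})
    (Pr : probability (path_space Z) R) : Prop :=
  (forall B : set Z, measurable B -> Pr [set w | B (w 0%N)] = mu B) /\
  (forall (n : nat) (A : set (path_space Z)) (B : set Z),
     past n A -> measurable B ->
     Pr (A `&` [set w | B (w n.+1)]) = \int[Pr]_(w in A) K n (w n) B).

(* P*(A) = inf of P(B) over the measurable B containing A; it is P(A) when A is
   measurable. Used for events defined through kernel_dist, a supremum over all
   of X, whose measurability is not granted. *)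
Definition outer_prob {R : realType} d (T : measurableType d)
  (Pr : probability T R) (A : set T) : \bar R := mu_ext Pr A.

(* Main.v *)
Require Import Defs.
From HB Require Import structures.
From mathcomp Require Import all_boot all_order all_algebra.
From mathcomp Require Import all_classical all_reals all_analysis.
From mathcomp Require Import measurable_realfun.
From mathcomp Require Import ring lra.

Set Implicit Arguments.
Unset Strict Implicit.
Unset Printing Implicit Defensive.
Import Order.TTheory GRing.Theory Num.Theory.
Import numFieldNormedType.Exports.

Local Open Scope classical_set_scope.
Local Open Scope ring_scope.
Local Open Scope ereal_scope.

(* Write |f| <= M V^beta, beta < s < 1 - alpha and eta = s + alpha < 1. The drift of V
   yields, by concavity, a drift of V^eta, which makes
     (1 + lam V^eta (X_n)) exp (lam eta (c/2 sum_(i < n) V^s (X_i) - b n))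
   a supermartingale as long as lam V^eta <= 1. With lam = n^(-r), eta < r < 1, and the
   maximal inequality for V (X_i), i < n, at level n^(r/eta), this bounds
   P (sum_(i < n) V^s (X_i) > K n) by a negative power of n; Borel-Cantelli along
   n = 2^j then bounds the averages of V^s (X_i) almost surely. Hence X_i lies outside
   {V <= d} with a frequency that is small for large d, and f can be truncated.
     For bounded g and a fixed lag L, the averages of g (X_(i+L)) minus its conditional
   expectation given the first i steps vanish (orthogonal increments, along n = j^2).
   That conditional expectation is E^(i)_(X_i, theta_i) g (X_L). Let L = q + N: after q
   steps the adaptation is slow, so theta may be frozen during the last N steps at a
   cost controlled by D, and P_theta^N g is close to pi (g) uniformly on {V <= d}.
   Choosing d, then N, then q makes the error small. *)

(** * A two-step law from its kernel *)

(** The exponents come from a tension. The drift directly gives only the linear bound [m + b n] on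
    the mean of V (X_n), so exceeding a level v0 before time n costs (m + b n) / v0 and v0 must grow
    faster than n. The supermartingale needs lam v0^eta <= 1, and its exponential gain exp (- lam
    eta n) needs lam n to diverge. With lam = n^(-r) and v0 = n^(r/eta) this means eta < r < 1, so
    there is room because eta < 1, that is s < 1 - alpha. On the other side s > beta lets V^s
    dominate the discarded part of f with a factor that tends to 0. The second failure appears as
    the conditional expectation of the indicator of V > d at lag q; a second use of the lagged law
    of large numbers turns it back into a frequency along the path. *)

Section kernel_precomposition.
Context {R : realType} d d' d'' (X : measurableType d) (Y : measurableType d')
  (Z : measurableType d'').
Variables (k : R.-pker Y ~> Z) (h : X -> Y) (mh : measurable_fun setT h).

Definition kprecomp of measurable_fun setT h : X -> {measure set Z -> \bar R} :=
  fun x => k (h x).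

Let measurable_kprecomp U : measurable U ->
  measurable_fun setT (kprecomp mh ^~ U).
Proof. by move=> mU; exact: measurableT_comp (measurable_kernel k _ mU) mh. Qed.

HB.instance Definition _ := isKernel.Build _ _ X Z R (kprecomp mh)
  measurable_kprecomp.

Let kprecomp_setT x : kprecomp mh x setT = 1.
Proof. exact: prob_kernel. Qed.

HB.instance Definition _ := Kernel_isProbability.Build _ _ X Z R (kprecomp mh)
  kprecomp_setT.

End kernel_precomposition.

Section graph_kernel.
Context {R : realType} d d1 d2 (T : measurableType d) (Y : measurableType d1)
  (Z : measurableType d2).
Variables (p : T -> Y) (mp : measurable_fun setT p) (k : R.-pker Y ~> Z).

(* The unit component is the parameter that the composition kcomp expects. *)
Definition kgraph_fun of measurable_fun setT p :
  unit * T -> set (Y * Z) -> \bar R :=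
  fun x => pushforward (k (p x.2)) (pair (p x.2)).

Let mpair (y : Y) : measurable_fun setT (pair y : Z -> Y * Z).
Proof. exact: measurable_pair1. Qed.

Let kgraph0 x : kgraph_fun mp x set0 = 0.
Proof. by rewrite /kgraph_fun /pushforward preimage_set0 measure0. Qed.

Let kgraph_ge0 x A : 0 <= kgraph_fun mp x A.
Proof. exact: measure_ge0. Qed.

Let kgraph_sigma_additive x : semi_sigma_additive (kgraph_fun mp x).
Proof.
have := mpair (p x.2); rewrite /kgraph_fun => mf.
exact: measure_semi_sigma_additive.
Qed.

HB.instance Definition _ x := isMeasure.Build _ _ _ (kgraph_fun mp x)
  (kgraph0 x) (kgraph_ge0 x) (@kgraph_sigma_additive x).

Definition kgraph : unit * T -> {measure set (Y * Z) -> \bar R} :=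
  kgraph_fun mp.

Let measurable_kgraph U : measurable U -> measurable_fun setT (kgraph ^~ U).
Proof.
move=> mU.
have -> : kgraph ^~ U = (fun y => k y (xsection U y)) \o (p \o snd).
  by apply/funext => y; rewrite /kgraph/= /kgraph_fun /pushforward/= xsectionE.
apply: measurableT_comp; last exact: measurableT_comp.
by apply: measurable_fun_xsection_finite_kernel; rewrite inE.
Qed.

HB.instance Definition _ := isKernel.Build _ _ _ _ R kgraph measurable_kgraph.

Let kgraph_setT y : kgraph y setT = 1.
Proof. exact: prob_kernel. Qed.

HB.instance Definition _ := Kernel_isProbability.Build _ _ _ _ R kgraph
  kgraph_setT.

End graph_kernel.

Section joint_law.
Context {R : realType} d d1 d2 (T : measurableType d) (Y : measurableType d1)
  (Z : measurableType d2).
Variables (Pr : probability T R) (p : T -> Y) (q : T -> Z) (k : R.-pker Y ~> Z).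
Hypotheses (mp : measurable_fun setT p) (mq : measurable_fun setT q).
Hypothesis pqk : forall A B, measurable A -> measurable B ->
  Pr (p @^-1` A `&` q @^-1` B) = \int[Pr]_(w in p @^-1` A) k (p w) B.

(** Both sides integrate [G] against measures on [Y * Z] that agree on rectangles by [pqk], and
    rectangles form a generating pi-system. The second measure is [Pr], seen as a kernel from
    [unit], composed with the graph kernel. *)
Lemma joint_law (G : Y * Z -> \bar R) : measurable_fun setT G ->
  (forall z, 0 <= G z) ->
  \int[Pr]_w G (p w, q w) = \int[Pr]_w \int[k (p w)]_z G (p w, z).
Proof.
move=> mG G0.
have mpq : measurable_fun setT (fun w => (p w, q w)).
  exact: measurable_fun_pair.
pose l : R.-pker unit ~> T := kprobability
  (@measurable_cst _ _ _ (pprobability T R) setT Pr).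
have -> : \int[Pr]_w G (p w, q w) =
    \int[pushforward Pr (fun w => (p w, q w))]_x G x.
  by rewrite ge0_integral_pushforward// preimage_setT.
transitivity (\int[kcomp l (kgraph mp k) tt]_x G x).
  apply: eq_measure_integral => /= A mA _.
  pose rect := [set A `*` B | A in @measurable _ Y & B in @measurable _ Z].
  apply: (measure_unique rect (fun=> setT)) => //.
  - exact: measurable_prod_measurableType.
  - move=> _ _ [A1 mA1 [B1 mB1 <-]] [A2 mA2 [B2 mB2 <-]].
    exists (A1 `&` A2); first exact: measurableI.
    by exists (B1 `&` B2); [exact: measurableI|rewrite setXI].
  - by move=> _; exists setT => //; exists setT => //; rewrite setXTT.
  - by rewrite bigcup_const.
  - move=> _ [A1 mA1 [B1 mB1 <-]].
    rewrite /pushforward/=.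
    rewrite [LHS](pqk mA1 mB1) [LHS]integral_mkcond; apply: eq_integral => w _.
    rewrite patchE; case: ifPn => pwA; rewrite /kgraph /kgraph_fun /pushforward/=.
      congr (k (p w) _); apply/seteqP; split => z //= Bz.
        by split => //; rewrite inE in pwA.
      by case: Bz.
    rewrite -[LHS](measure0 (k (p w))); congr (k (p w) _).
    by apply/seteqP; split => z //= [] pA1; rewrite mem_set in pwA.
  - move=> _. rewrite /= /pushforward/= preimage_setT probability_setT. exact: ltry.
rewrite integral_kcomp//=; apply: eq_integral => w _.
by rewrite [LHS]ge0_integral_pushforward// preimage_setT.
Qed.
End joint_law.

(** * Chains on the canonical space *)

(** The same paths with the smaller sigma-algebra [past n]: measurability on this type encodes being
    adapted at time [n]. *)
Definition past_space {d} (Z : measurableType d) (n : nat) :=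
  g_sigma_algebraType (@coord_events d Z `I_n.+1).

Section chain_law.
Context {R : realType} {d} {Z : measurableType d}.

Lemma measurable_coord n : measurable_fun setT (fun w : path_space Z => w n).
Proof.
by move=> _ B mB; apply: sub_sigma_algebra; exists n => //; exists B.
Qed.

Lemma measurable_coord_past n i : (i <= n)%N ->
  measurable_fun setT (fun w : past_space Z n => w i).
Proof.
by move=> ni _ B mB; apply: sub_sigma_algebra; exists i => //; exists B.
Qed.

Lemma measurable_past n :
  measurable_fun setT (fun w : path_space Z => w : past_space Z n).
Proof.
move=> _ B mB; rewrite setTI preimage_id.
by apply: sub_smallest2r mB => // A [i _ iA]; exists i.
Qed.

Lemma measurable_of_past n d' (Y : measurableType d') (f : (nat -> Z) -> Y) :
  measurable_fun setT (f : past_space Z n -> Y) ->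
  measurable_fun setT (f : path_space Z -> Y).
Proof.
move=> mf; exact: (measurableT_comp (f := f : past_space Z n -> Y) mf
  (@measurable_past n)).
Qed.

Variables (K : nat -> R.-pker Z ~> Z) (mu : {measure set Z -> \bar R})
  (Pr : probability (path_space Z) R).
Hypothesis law : is_chain_law K mu Pr.

(** The Markov property with the whole past kept as an argument of [G], as the martingale and
    supermartingale steps require. It is [joint_law] for the identity into the past, with [K n] read
    as a kernel on paths through coordinate [n]. *)
Lemma chain_step n (G : past_space Z n * Z -> \bar R) :
  measurable_fun setT G -> (forall z, 0 <= G z) ->
  \int[Pr]_w G (w, w n.+1) = \int[Pr]_w \int[K n (w n)]_z G (w, z).
Proof.
move=> mG G0.
have mn := @measurable_coord_past n n (leqnn n).
apply: (@joint_law _ _ _ _ (path_space Z) (past_space Z n) Z Pr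
  (fun w => w : past_space Z n) (fun w => w n.+1) (kprecomp (K n) mn)) => //.
- exact: measurable_past.
- exact: measurable_coord.
- by move=> A B mA mB; rewrite (law.2 n).
Qed.

Lemma chain_step_le n (G : past_space Z n * Z -> \bar R)
    (F : past_space Z n -> \bar R) :
  measurable_fun setT G -> (forall z, 0 <= G z) -> measurable_fun setT F ->
  (forall w : past_space Z n, \int[K n (w n)]_z G (w, z) <= F w) ->
  \int[Pr]_w G (w, w n.+1) <= \int[Pr]_w F w.
Proof.
move=> mG G0 mF GF; rewrite chain_step//.
have mn := @measurable_coord_past n n (leqnn n).
apply: ge0_le_integral => //.
- by move=> w _; exact: integral_ge0.
- apply: (measurableT_comp (f := fun w : past_space Z n =>
    \int[kprecomp (K n) mn w]_z G (w, z))); last exact: measurable_past.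
  exact: measurable_fun_integral_finite_kernel.
- by apply: measurableT_comp mF _; exact: measurable_past.
Qed.

Lemma chain_init (phi : Z -> \bar R) :
  measurable_fun setT phi -> (forall z, 0 <= phi z) ->
  \int[Pr]_w phi (w 0%N) = \int[mu]_z phi z.
Proof.
move=> mphi phi0.
have m0 := @measurable_coord 0.
transitivity (\int[pushforward Pr (fun w : path_space Z => w 0%N)]_z phi z).
  by rewrite ge0_integral_pushforward// preimage_setT.
by apply: eq_measure_integral => A mA _; exact: law.1.
Qed.

End chain_law.

(** * Almost sure convergence *)

Section probability_tools.
Context {R : realType} {d} {T : measurableType d}.
Variable mu : {measure set T -> \bar R}.

Lemma bounded_integrable (f : T -> R) (B : R) : mu setT = 1 ->
  measurable_fun setT f -> (forall x, (`|f x| <= B)%R) ->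
  mu.-integrable setT (EFin \o f).
Proof.
move=> mu1 mf fB; apply: measurable_bounded_integrable => //.
  by rewrite mu1 ltry.
exists B; split; first exact: num_real.
by move=> M BM x _ /=; rewrite (le_trans (fB x))// ltW.
Qed.

(** The random series has expectation at most [C], so it is almost surely finite and its terms tend
    to 0. For indicators this is Borel-Cantelli; for squares it gives convergence from second
    moments. *)
Lemma ae_cvg0_summable (X : nat -> T -> R) (a : nat -> R) (C : R) :
  (forall n, measurable_fun setT (X n)) -> (forall n x, (0 <= X n x)%R) ->
  (forall n, \int[mu]_x (X n x)%:E <= (a n)%:E) ->
  (forall n, (\sum_(0 <= i < n) a i <= C)%R) ->
  {ae mu, forall x, X n x @[n --> \oo] --> 0%R}.
Proof.
move=> mX X0 Xa aC.
have mEX n : measurable_fun setT (EFin \o X n) by exact/measurable_EFinP.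
have EX0 n x : setT x -> 0 <= (X n x)%:E by rewrite lee_fin.
have S0 x : 0 <= \sum_(n <oo) (X n x)%:E 
  by apply: nneseries_ge0 => n _ _; rewrite lee_fin.
have intS : mu.-integrable setT (fun x => \sum_(n <oo) (X n x)%:E).
  apply/integrableP; split.
    rewrite [X in measurable_fun _ X](_ : _ =
    (fun x => \sum_(n <oo | n \in xpredT) (EFin \o X n) x))//.
  by apply: ge0_emeasurable_sum => // k x _ _ /=; rewrite lee_fin.
  under eq_integral do rewrite gee0_abs//.
  rewrite (integral_nneseries mu measurableT mEX EX0).
  apply: (@le_lt_trans _ _ C%:E); last exact: ltry.
  apply: lime_le.
    by apply: is_cvg_nneseries => n _ _; apply: integral_ge0 => x _; rewrite lee_fin.
  apply: nearW => n; apply: le_trans (_ : (\sum_(0 <= i < n) a i)%:E <= _).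
    by rewrite -sumEFin; apply: lee_sum => i _; exact: Xa.
  by rewrite lee_fin.
apply: filterS (integrable_ae measurableT intS) => x /(_ Logic.I) fx.
apply: cvg_series_cvg_0; apply: nnseries_is_cvg => //.
by rewrite ltey_eq fx.
Qed.

Lemma markov_le (f : T -> R) (a I : R) (A : set T) : measurable A ->
  measurable_fun setT f -> (forall x, (0 <= f x)%R) -> (0 < a)%R ->
  (forall x, A x -> (a <= f x)%R) -> \int[mu]_x (f x)%:E <= I%:E ->
  mu A <= (I / a)%:E.
Proof.
move=> mA mf f0 a0 af fI.
rewrite mulrC EFinM lee_pdivlMl//; apply: le_trans fI.
rewrite -integral_cst//.
apply: (@le_trans _ _ (\int[mu]_(x in A) (f x)%:E)).
  apply: ge0_le_integral => //=.
  - by move=> x _; rewrite lee_fin ltW.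
  - by apply: measurable_funTS; exact/measurable_EFinP.
apply: ge0_subset_integral => //; first exact/measurable_EFinP.
by move=> x _; rewrite lee_fin.
Qed.

Lemma ae_mono (P Q : T -> Prop) : (forall x, P x -> Q x) ->
  {ae mu, forall x, P x} -> {ae mu, forall x, Q x}.
Proof. by move=> PQ; apply: filterS. Qed.

Lemma ae_mono2 (P Q S : T -> Prop) : (forall x, P x -> Q x -> S x) ->
  {ae mu, forall x, P x} -> {ae mu, forall x, Q x} -> {ae mu, forall x, S x}.
Proof. by move=> PQS; apply: filterS2. Qed.

End probability_tools.

(** * From averages along squares to all averages *)

Section cesaro.
Context {R : realType}.
Local Open Scope ring_scope.

Lemma inv_sq_sum (n : nat) : (\sum_(0 <= i < n) (i.+1%:R ^- 2) <= 2 :> R)%R.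
Proof.
case: n => [|n]; first by rewrite big_nil.
(* The strengthened bound is inductive because 1/(x+1)^2 <= 1/x - 1/(x+1). *)
suff : (\sum_(0 <= i < n.+1) (i.+1%:R ^- 2) <= 2 - n.+1%:R^-1 :> R)%R.
  by move=> /le_trans; apply; rewrite gerBl.
elim: n => [|n IH]; first by rewrite big_nat1 mulr1n expr1n invr1; lra.
rewrite big_nat_recr//=; apply: le_trans (lerD IH (lexx _)) _.
rewrite -(natr1 n.+1); have := ltr0Sn R n; move: (n.+1%:R : R) => x x0.
rewrite -subr_ge0 (_ : (_ - _)%R = (x * (x + 1) ^+ 2)^-1)%R.
  by rewrite invr_ge0 mulr_ge0 ?sqr_ge0//; lra.
by field; lra.
Qed.

Lemma square_floor (n : nat) : exists j, (j ^ 2 <= n < j.+1 ^ 2)%N.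
Proof.
elim: n => [|n [j /andP[jn nj]]]; first by exists 0%N.
have [h|h] := ltnP n.+1 (j.+1 ^ 2); first by exists j; rewrite h (leq_trans jn).
by exists j.+1; rewrite h (leq_ltn_trans nj)// ltn_exp2r.
Qed.

(* Between two consecutive squares an increment bounded by 1 changes the average
   negligibly. *)
Lemma cvg_average_squares (M : nat -> R) :
  (forall n, `|M n.+1 - M n| <= 1)%R ->
  ((M (j ^ 2)%N / (j ^ 2)%:R) @[j --> \oo] --> 0)%R ->
  ((n%:R^-1 * M n) @[n --> \oo] --> 0)%R.
Proof.
move=> M1 Msq.
have Mnk n k : (`|M (n + k)%N - M n| <= k%:R)%R.
  elim: k => [|k IH]; first by rewrite addn0 subrr normr0.
  rewrite addnS -(subrKA (M (n + k)%N)) -natr1 addrC.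
  by rewrite (le_trans (ler_normD _ _))// lerD.
apply/cvgrPdist_le => e e0.
have e2 : (0 < e / 2)%R by rewrite divr_gt0.
move/cvgrPdist_le : Msq => /(_ _ e2) [J _ HJ].
(* At most 2j steps separate n from the square j^2 below it, and 2j <= (e/2) j^2 as soon as j >=
   4/e. *)
have [m me] : exists m : nat, (4 / e <= m%:R)%R.
  by exists (Num.truncn (4 / e)).+1; exact/ltW/truncnS_gt.
near=> n.
have [j /andP[jn nj]] := square_floor n.
have j0 : (maxn J m.+1 <= j)%N.
  rewrite leqNgt; apply/negP => jJ.
  have : (n < (maxn J m.+1) ^ 2)%N by rewrite (leq_trans nj)// leq_exp2r.
  by rewrite ltnNge => /negP; apply; near: n; exists (maxn J m.+1 ^ 2)%N.
have jR : (m.+1%:R <= j%:R :> R)%R.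
  by rewrite ler_nat (leq_trans _ j0)// leq_maxr.
have jpos : (0 < j%:R :> R)%R by rewrite (lt_le_trans _ jR).
have jsq : (0 < (j ^ 2)%:R :> R)%R by rewrite natrX exprn_gt0.
have n0 : (0 < n%:R :> R)%R by rewrite (lt_le_trans jsq)// ler_nat.
have := HJ j (leq_trans (leq_maxl _ _) j0).
rewrite /= !sub0r !normrN !normrM !normfV (ger0_norm (ltW jsq)) (ger0_norm (ltW n0)).
rewrite ler_pdivrMr// => Mj.
rewrite mulrC ler_pdivrMr//.
have := Mnk (j ^ 2)%N (n - j ^ 2)%N; rewrite subnKC// => Mn.
have nj2 : ((n - j ^ 2)%:R <= 2 * j%:R :> R)%R.
  rewrite -natrM ler_nat leq_subLR -ltnS (leq_trans nj)//.
  by rewrite -addn1 sqrnD muln1 exp1n addnAC addn1.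
have je : (2 * j%:R <= e / 2 * (j ^ 2)%:R :> R)%R.
  rewrite natrX expr2 mulrA ler_pM2r//.
  have := le_trans me (le_trans _ jR); rewrite ler_nat => /(_ (leqnSn m)).
  by rewrite ler_pdivrMr// => h; lra.
have nn : ((j ^ 2)%:R <= n%:R :> R)%R by rewrite ler_nat.
have en : (e / 2 * (j ^ 2)%:R <= e / 2 * n%:R)%R by rewrite ler_pM2l.
have := ler_normD (M n - M (j ^ 2)%N) (M (j ^ 2)%N); rewrite subrK.
lra.
Unshelve. all: by end_near.
Qed.

End cesaro.

(** * Transition operators and the law of large numbers with a lag *)

Section unit_functions.
Context {R : realType}.
Local Open Scope ring_scope.

(** Such functions are integrable for every probability and stable under kernels, so real and
    extended integrals can be exchanged freely. General bounded functions are recovered by an affine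
    change in [bounded_lln]. *)
Definition unit_fun d (T : measurableType d) (phi : T -> R) : Prop :=
  measurable_fun setT phi /\ forall x, 0 <= phi x <= 1.

Section unit_integral.
Context {d} {T : measurableType d} (mu : {measure set T -> \bar R}).
Hypothesis mu1 : mu setT = 1%E.

Lemma unit_fun_integrable (phi : T -> R) : unit_fun phi ->
  mu.-integrable setT (EFin \o phi).
Proof.
move=> [mphi phi01]; apply: (bounded_integrable (B := 1)) => // x.
by have /andP[p0 p1] := phi01 x; rewrite ger0_norm.
Qed.

Lemma unit_fun_RintegralE (phi : T -> R) : unit_fun phi ->
  (\int[mu]_x phi x)%:E = (\int[mu]_x (phi x)%:E)%E.
Proof.
by move=> uphi; rewrite fineK//; exact/integrable_fin_num/unit_fun_integrable.
Qed.

Lemma unit_fun_Rintegral01 (phi : T -> R) : unit_fun phi ->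
  0 <= \int[mu]_x phi x <= 1.
Proof.
move=> uphi; have [mphi phi01] := uphi; rewrite -!lee_fin unit_fun_RintegralE//.
rewrite integral_ge0/=; last first.
  by move=> x _; rewrite lee_fin; case/andP: (phi01 x).
rewrite -[leRHS]mu1 -[leRHS]mul1e -integral_cst//.
apply: ge0_le_integral => //=.
- by move=> x _; rewrite lee_fin; case/andP: (phi01 x).
- exact/measurable_EFinP.
- by move=> x _; rewrite lee_fin; case/andP: (phi01 x).
Qed.

Lemma Rintegral_cst1 (r : R) : \int[mu]_x r = r.
Proof. by rewrite Rintegral_cst// mu1 mulr1. Qed.

(* The variance of a [0, 1]-valued variable is at most 1. *)
Lemma unit_fun_second_moment (phi : T -> R) (m : R) : unit_fun phi ->
  (\int[mu]_x ((m + phi x - \int[mu]_x phi x) ^+ 2)%:E <= (m ^+ 2 + 1)%:E)%E.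
Proof.
move=> uphi; have [mphi phi01] := uphi.
have /andP[e0 e1] := unit_fun_Rintegral01 uphi.
set e := \int[mu]_x phi x in e0 e1 *.
have iphi := unit_fun_integrable uphi.
(* Since phi^2 <= phi, [h] dominates the square; being affine in [phi], its integral involves only
   the mean [e]. *)
pose h x := ((m - e) ^+ 2) + ((2 * (m - e) + 1) * phi x).
have ic : mu.-integrable setT (EFin \o cst ((m - e) ^+ 2)).
  by apply: (bounded_integrable (B := `|(m - e) ^+ 2|)).
have iz : mu.-integrable setT (EFin \o (fun x => (2 * (m - e) + 1) * phi x)).
  apply: (bounded_integrable (B := `|2 * (m - e) + 1|)) => //.
    exact: measurable_funM.
  move=> x; have /andP[p0 p1] := phi01 x.
  by rewrite normrM (ger0_norm p0) ler_piMr.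
have -> : (m ^+ 2 + 1)%:E = (m ^+ 2 + 1 - (m ^+ 2 + e - e ^+ 2) +
   (m ^+ 2 + e - e ^+ 2))%:E by congr EFin; ring.
have ih : (\int[mu]_x (h x)%:E = (m ^+ 2 + e - e ^+ 2)%:E)%E.
  have := RintegralD measurableT ic iz.
  rewrite RintegralZl// Rintegral_cst// mu1 mulr1 -/e => E.
  rewrite (_ : m ^+ 2 + e - e ^+ 2 = \int[mu]_x h x); last by rewrite /h E; ring.
  rewrite fineK//; apply: integrable_fin_num => //.
  apply: (bounded_integrable (B := (m - e) ^+ 2 + `|2 * (m - e) + 1|)) => //.
    by apply: measurable_funD => //; exact: measurable_funM.
  move=> x; rewrite (le_trans (ler_normD _ _))// ger0_norm ?sqr_ge0// lerD2l.
  by have /andP[p0 p1] := phi01 x; rewrite normrM (ger0_norm p0) ler_piMr.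
apply: (@le_trans _ _ (m ^+ 2 + e - e ^+ 2)%:E); last first.
  by rewrite lee_fin; nra.
rewrite -ih; apply: ge0_le_integral => //=.
- by move=> x _; rewrite lee_fin sqr_ge0.
- apply/measurable_EFinP; apply: measurable_funX.
  by apply: measurable_funB => //; exact: measurable_funD.
- by apply/measurable_EFinP; apply: measurable_funD => //; exact: measurable_funM.
- by move=> x _; rewrite lee_fin /h; have /andP[? ?] := phi01 x; nra.
Qed.

End unit_integral.

Lemma unit_fun_cst d (T : measurableType d) (r : R) : 0 <= r <= 1 ->
  unit_fun (fun _ : T => r).
Proof. by move=> r01; split. Qed.

Definition transfer d d' (X : measurableType d) (Y : measurableType d')
  (k : R.-pker X ~> Y) (phi : Y -> R) (x : X) : R := \int[k x]_y phi y.

Lemma transfer_unit d d' (X : measurableType d) (Y : measurableType d')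
  (k : R.-pker X ~> Y) (phi : Y -> R) : unit_fun phi -> unit_fun (transfer k phi).
Proof.
move=> uphi; split; last first.
  by move=> x; apply: unit_fun_Rintegral01 => //; exact: prob_kernel.
apply: measurableT_comp => //.
apply: (measurable_fun_integral_kernel (l := k)).
- by move=> U mU; exact: measurable_kernel.
- by move=> y; rewrite lee_fin; case/andP: (uphi.2 y).
- by apply/measurable_EFinP; case: uphi.
Qed.

End unit_functions.

Section transfer_iteration.
Context {R : realType} {d} {Z : measurableType d} (K : nat -> R.-pker Z ~> Z).
Local Open Scope ring_scope.

(** The product K_l K_(l+1) ... K_(l+n-1) applied to [phi], that is, the expectation of [phi] at
    time [n] for the chain whose clock starts at [l]. The recursion peels off the last step, as
    conditioning on the past does. *)
Fixpoint transfers (l n : nat) (phi : Z -> R) : Z -> R :=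
  if n is n'.+1 then transfers l n' (transfer (K (l + n')%N) phi) else phi.

Lemma transfers_unit l n phi : unit_fun phi -> unit_fun (transfers l n phi).
Proof.
by elim: n phi => //= n IH phi uphi; apply: IH; exact: transfer_unit.
Qed.

End transfer_iteration.

Section chain_lln.
Context {R : realType} {d} {Z : measurableType d} (K : nat -> R.-pker Z ~> Z)
  (mu : {measure set Z -> \bar R}) (Pr : probability (path_space Z) R).
Hypothesis law : is_chain_law K mu Pr.
Local Open Scope ring_scope.

Lemma chain_transfer n (phi : Z -> R) : unit_fun phi ->
  (\int[Pr]_w (phi (w n.+1))%:E = \int[Pr]_w (transfer (K n) phi (w n))%:E)%E.
Proof.
move=> uphi; rewrite (chain_step law (n := n) (G := fun z => (phi z.2)%:E)).
- by apply: eq_integral => w _; rewrite unit_fun_RintegralE//; exact: prob_kernel.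
- by apply/measurable_EFinP; apply: measurableT_comp => //; case: uphi.
- by move=> z; rewrite lee_fin; case/andP: (uphi.2 z.2).
Qed.

Lemma chain_transfers n (phi : Z -> R) : unit_fun phi ->
  (\int[Pr]_w (phi (w n))%:E = \int[mu]_z (transfers K 0 n phi z)%:E)%E.
Proof.
elim: n phi => [|n IH] phi uphi /=.
  apply: (chain_init law (phi := EFin \o phi)).
    by apply/measurable_EFinP; case: uphi.
  by move=> z; rewrite lee_fin; case/andP: (uphi.2 z).
by rewrite chain_transfer// add0n IH//; exact: transfer_unit.
Qed.

Variable psi : nat -> Z -> R.
Hypothesis upsi : forall k, unit_fun (psi k).

Definition martingale_diff (k : nat) (w : nat -> Z) : R :=
  psi k (w k.+1) - transfer (K k) (psi k) (w k).

Definition martingale_sum (n : nat) (w : nat -> Z) : R :=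
  \sum_(0 <= k < n) martingale_diff k w.

Lemma martingale_diff_le1 k w : `|martingale_diff k w| <= 1.
Proof.
have /andP[a0 a1] := (upsi k).2 (w k.+1).
have /andP[b0 b1] := (transfer_unit (K k) (upsi k)).2 (w k).
by rewrite ler_norml /martingale_diff; lra.
Qed.

Lemma measurable_martingale_sum n m : (n <= m)%N ->
  measurable_fun setT (martingale_sum n : past_space Z m -> R).
Proof.
elim: n => [|n IH] nm.
  rewrite (_ : martingale_sum 0 = cst 0)//.
  by apply/funext => w; rewrite /martingale_sum big_nil.
rewrite (_ : martingale_sum n.+1 = martingale_sum n \+ martingale_diff n); last first.
  by apply/funext => w; rewrite /martingale_sum big_nat_recr.
have mn := IH (ltnW nm).
apply: (@measurable_funD _ (past_space Z m)) => //.
apply: measurable_funB; apply: measurableT_comp.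
- by case: (upsi n).
- exact: measurable_coord_past.
- by case: (transfer_unit (K n) (upsi n)).
- by apply: measurable_coord_past; exact: ltnW.
Qed.

(** Given the past, an increment has mean 0 and variance at most 1, so each step adds at most 1:
    this is [unit_fun_second_moment] with [m] the current sum. *)
Lemma martingale_sum_second_moment n :
  (\int[Pr]_w ((martingale_sum n w) ^+ 2)%:E <= n%:R%:E)%E.
Proof.
elim: n => [|n IH].
  under eq_integral do rewrite /martingale_sum big_nil expr0n/=.
  by rewrite integral0.
pose G (z : past_space Z n * Z) : R :=
  martingale_sum n z.1 + psi n z.2 - transfer (K n) (psi n) (z.1 n).
have mM := measurable_martingale_sum (leqnn n).
have mG : measurable_fun setT G.
  apply: measurable_funB; first apply: measurable_funD.
  - exact: measurableT_comp.
  - by apply: measurableT_comp => //; case: (upsi n).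
  - apply: (measurableT_comp (f := transfer (K n) (psi n))).
      by case: (transfer_unit (K n) (upsi n)).
    by apply: measurableT_comp (@measurable_coord_past _ Z n n _) _.
have -> : (\int[Pr]_w ((martingale_sum n.+1 w) ^+ 2)%:E =
    \int[Pr]_w (G (w, w n.+1) ^+ 2)%:E)%E.
  apply: eq_integral => w _.
  by rewrite /martingale_sum big_nat_recr//= /martingale_diff addrA.
have mM' : measurable_fun setT (martingale_sum n : path_space Z -> R).
  exact: measurable_of_past mM.
apply: (@le_trans _ _ (\int[Pr]_w (((martingale_sum n w) ^+ 2)%:E + 1))%E).
  apply: (chain_step_le law (G := fun z => (G z ^+ 2)%:E)
    (F := fun w => ((martingale_sum n w ^+ 2)%:E + 1)%E)).
  - by apply/measurable_EFinP; exact: measurable_funX.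
  - by move=> z; rewrite lee_fin sqr_ge0.
  - by apply: emeasurable_funD => //; apply/measurable_EFinP; exact: measurable_funX.
  - move=> w; rewrite -EFinD.
    have K1 : K n (w n) setT = 1%E by exact: prob_kernel.
    exact: (unit_fun_second_moment K1 (martingale_sum n w) (upsi n)).
rewrite ge0_integralD//=.
- have -> : (\int[Pr]__ 1 = 1 :> \bar R)%E.
    by rewrite integral_cst// mul1e; exact: probability_setT.
  by rewrite -natr1 EFinD leeD.
- by move=> w _; rewrite lee_fin sqr_ge0.
- by apply/measurable_EFinP; exact: measurable_funX.
Qed.

Lemma martingale_sum_cvg0 :
  {ae Pr, forall w, n%:R^-1 * martingale_sum n w @[n --> \oo] --> 0}.
Proof.
(* The squared average at time (j+1)^2 has mean at most (j+1)^(-2), which is summable. Starting at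
   [j.+1] avoids the division by 0. *)
pose sq j : R := (j.+1 ^ 2)%:R.
have sq0 j : 0 < sq j by rewrite ltr0n expn_gt0.
have mM n : measurable_fun setT (martingale_sum n : path_space Z -> R).
  exact: measurable_of_past (measurable_martingale_sum (leqnn n)).
have H := @ae_cvg0_summable R _ _ Pr
  (fun j w => (martingale_sum (j.+1 ^ 2) w / sq j) ^+ 2) (fun j => j.+1%:R ^- 2) 2.
apply: ae_mono (H _ _ _ _).
- move=> w Hw; apply: cvg_average_squares.
    by move=> n; rewrite /martingale_sum big_nat_recr//= addrAC subrr add0r
      martingale_diff_le1.
  rewrite -(cvg_shiftS (fun j => martingale_sum (j ^ 2) w / (j ^ 2)%:R)).
  apply/norm_cvg0P.
  rewrite [X in X @ _](_ : _ =
    fun j => Num.sqrt ((martingale_sum (j.+1 ^ 2) w / sq j) ^+ 2)); last first.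
    by apply/funext => j; rewrite sqrtr_sqr.
  rewrite -[X in _ --> X]sqrtr0; apply: continuous_cvg => //.
  exact: sqrt_continuous.
- by move=> j; apply: measurable_funX; exact: measurable_funM.
- by move=> j w; exact: sqr_ge0.
- move=> j.
  under eq_integral do rewrite exprMn mulrC EFinM.
  rewrite ge0_integralZl_EFin ?sqr_ge0//; last 2 first.
  - by move=> w _; rewrite lee_fin sqr_ge0.
  - by apply/measurable_EFinP; exact: measurable_funX.
  apply: (le_trans (lee_wpmul2l _ (martingale_sum_second_moment _))).
    by rewrite lee_fin sqr_ge0.
  rewrite -EFinM lee_fin -/(sq j) expr2 -mulrA mulVf ?gt_eqF// mulr1 /sq natrX.
  by [].
- exact: inv_sq_sum.
Qed.

End chain_lln.

Section chain_lln_lag.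
Context {R : realType} {d} {Z : measurableType d} (K : nat -> R.-pker Z ~> Z)
  (mu : {measure set Z -> \bar R}) (Pr : probability (path_space Z) R).
Hypothesis law : is_chain_law K mu Pr.
Local Open Scope ring_scope.

(** Induction on the lag: a difference of lag L + 1 is a martingale increment at time i + L plus a
    difference of lag L for [transfer (K (i + L)) (phi i)]. That function depends on i even when
    [phi] does not, which forces a family indexed by i. *)
Lemma chain_lln_lag (L : nat) (phi : nat -> Z -> R) :
  (forall i, unit_fun (phi i)) ->
  {ae Pr, forall w, n%:R^-1 * \sum_(0 <= i < n)
     (phi i (w (i + L)%N) - transfers K i L (phi i) (w i)) @[n --> \oo] --> 0}.
Proof.
elim: L phi => [|L IH] phi uphi.
  apply: aeW => w; rewrite (_ : (fun n => _) = cst 0); first exact: cvg_cst.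
  apply/funext => n; rewrite big1 ?mulr0// => i _.
  by rewrite addn0 /= subrr.
(* The increments are reindexed by k = i + L; the zero function makes the first L of them vanish. *)
pose psi k := if (k < L)%N then (fun=> 0) : Z -> R else phi (k - L)%N.
have upsi k : unit_fun (psi k).
  by rewrite /psi; case: ifP => // _; apply: unit_fun_cst; rewrite lexx ler01.
have := IH (fun i => transfer (K (i + L)%N) (phi i)).
move=> /(_ (fun i => transfer_unit _ (uphi i))).
apply: ae_mono2 (martingale_sum_cvg0 law upsi) => w Hm Ht.
pose a n : R := n%:R^-1 * \sum_(0 <= i < n)
  (transfer (K (i + L)) (phi i) (w (i + L)%N) -
   transfers K i L (transfer (K (i + L)) (phi i)) (w i)).
(* The martingale sum has n + L terms but is divided by n; the factor (n + L) / n tends to 1. *)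
pose b n : R := (n + L)%:R / n%:R * ((n + L)%:R^-1 * martingale_sum K psi (n + L) w).
rewrite (_ : (fun n => _) = a \+ b); last first.
  apply/funext => n; rewrite /a /b /=.
  have [->|n0] := posnP n; first by rewrite invr0 !mul0r mulr0 mul0r addr0.
  have nL0 : (n + L)%:R != 0 :> R by rewrite pnatr_eq0 addn_eq0 negb_and -!lt0n n0.
  have E (x y z : R) : x != 0 -> x / y * (x^-1 * z) = y^-1 * z.
    by move=> x0; rewrite mulrAC mulrA mulfV// mul1r mulrC.
  rewrite E// -mulrDr; congr (_ * _).
  have -> : martingale_sum K psi (n + L) w =
      \sum_(0 <= i < n) martingale_diff K psi (i + L) w.
    rewrite /martingale_sum (@big_cat_nat _ _ _ L 0 (n + L)) ?leq_addl//=.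
    rewrite [X in X + _]big_nat [X in X + _]big1 ?add0r; last first.
      move=> k /andP[_ kL]; rewrite /martingale_diff /psi kL.
      by rewrite /transfer Rintegral_cst// mul0r subr0.
    by rewrite -{1}(add0n L) big_addn addnK.
  rewrite -big_split/=; apply: eq_bigr => i _.
  rewrite /martingale_diff /psi ltnNge leq_addl/= addnK.
  by rewrite addnS [RHS]addrC addrA subrK.
rewrite -[X in _ --> X]addr0; apply: cvgD => //.
rewrite -[X in _ --> X](mulr0 1); apply: cvgM; last first.
  by rewrite (cvg_shiftn L (fun n => n%:R^-1 * martingale_sum K psi n w)).
have : ((1 : R) + L%:R / n%:R) @[n --> \oo] --> (1 + 0 : R).
  apply: cvgD; first exact: cvg_cst.
  rewrite -[X in _ --> X](mulr0 L%:R); apply: cvgM; first exact: cvg_cst.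
  by rewrite -cvg_shiftS; exact: cvg_harmonic.
rewrite addr0; apply: cvg_trans; apply: near_eq_cvg; near=> n.
have n0 : (0 < n)%N by near: n; exists 1%N.
by rewrite natrD mulrDl mulfV// pnatr_eq0 -lt0n.
Unshelve. all: by end_near.
Qed.

End chain_lln_lag.

(** * Averages of a power of the Lyapunov function *)

Section real_lemmas.
Context {R : realType}.
Local Open Scope ring_scope.

(** Young's inequality for t^p times 1, with exponents 1/p and 1/(1-p), gives t^p <= p t + (1 - p);
    take t = y / x and multiply by x^p. *)
Lemma powR_tangent (p x y : R) : 0 < p < 1 -> 0 < x -> 0 <= y ->
  y `^ p <= x `^ p + p * (x `^ p / x) * (y - x).
Proof.
move=> /andP[p0 p1] x0 y0.
pose t := y / x; have t0 : 0 <= t by rewrite divr_ge0// ltW.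
have -> : y = t * x by rewrite /t divfK// gt_eqF.
have tp : t `^ p <= p * t + (1 - p).
  have p1' : 0 < 1 - p by rewrite subr_gt0.
  have := @conjugate_powR R (t `^ p) 1 p^-1 (1 - p)^-1.
  rewrite powR_ge0 ler01 !invr_gt0 p0 p1' !invrK subrKC mulr1 powR1 mul1r.
  move=> /(_ isT isT isT isT erefl); rewrite -powRrM mulfV ?gt_eqF// powRr1//.
  by rewrite mulrC.
rewrite powRM//; last exact: ltW.
apply: (le_trans (ler_wpM2r (powR_ge0 _ _) tp)).
by rewrite le_eqVlt; apply/orP; left; apply/eqP; field; rewrite gt_eqF.
Qed.

Lemma geometric_sum_le (r : R) n : 0 <= r < 1 ->
  \sum_(0 <= i < n) r ^+ i <= (1 - r)^-1.
Proof.
move=> /andP[r0 r1].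
have r1' : 0 < 1 - r by rewrite subr_gt0.
suff E : \sum_(0 <= i < n) r ^+ i = (1 - r ^+ n) / (1 - r).
  rewrite E ler_pdivrMr// mulVf ?gt_eqF// lerBlDr lerDl exprn_ge0//.
elim: n => [|n IH]; first by rewrite big_nil expr0 subrr mul0r.
by rewrite big_nat_recr//= IH exprS; field; rewrite gt_eqF.
Qed.

Lemma powR_expn2 (j : nat) (x : R) : ((2 ^ j)%:R : R) `^ x = (2 `^ x) ^+ j.
Proof. by rewrite natrX -powR_mulrn// -powRrM mulrC powRrM powR_mulrn ?powR_ge0. Qed.

Lemma powR2_lt1 (x : R) : x < 0 -> 0 <= 2 `^ x < 1.
Proof.
move=> x0; rewrite powR_ge0/= /powR ifF; last by apply/negbTE; rewrite pnatr_eq0.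
have l2 : 0 < ln (2 : R) by apply: ln_gt0; rewrite ltr1n.
by rewrite expR_lt1 nmulr_rlt0.
Qed.

(** The factor 2 is the price of replacing n by the power of two in (n, 2n], which monotonicity
    allows. *)
Lemma average_dyadic (S : nat -> R) (C : R) : nondecreasing_seq S -> 0 <= C ->
  (\forall j \near \oo, S (2 ^ j)%N <= C * (2 ^ j)%:R) ->
  \forall n \near \oo, S n <= 2 * C * n%:R.
Proof.
move=> ndS C0 [J _ HJ].
near=> n.
have n0 : (0 < n)%N by near: n; exists 1%N.
set j := (trunc_log 2 n).+1.
have nj : (n <= 2 ^ j)%N by rewrite ltnW// trunc_log_ltn.
have jn : (2 ^ j <= 2 * n)%N by rewrite expnS leq_pmul2l// trunc_logP.
have Jj : (J <= j)%N.
  rewrite leqNgt; apply/negP => jJ.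
  have : (n < 2 ^ J)%N by rewrite (leq_ltn_trans nj)// ltn_exp2l.
  by rewrite ltnNge => /negP; apply; near: n; exists (2 ^ J)%N.
apply: (le_trans (ndS _ _ nj)); apply: (le_trans (HJ j Jj)).
by rewrite (mulrC 2) -mulrA ler_wpM2l// -natrM ler_nat.
Unshelve. all: by end_near.
Qed.

End real_lemmas.

Section drift.
Context {R : realType} {d} {Z : measurableType d} (K : nat -> R.-pker Z ~> Z)
  (mu : {measure set Z -> \bar R}) (Pr : probability (path_space Z) R).
Hypothesis law : is_chain_law K mu Pr.
Local Open Scope ring_scope.
Variables (U : Z -> R) (alpha b c m s : R).
Hypotheses (mU : measurable_fun setT U) (U1 : forall z, 1 <= U z).
Hypotheses (b0 : 0 <= b) (c0 : 0 < c) (m0 : 0 <= m).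
Hypotheses (s0 : 0 <= s) (alpha0 : 0 < alpha) (s1 : s < 1 - alpha).
Hypothesis U_drift : forall n z,
  (\int[K n z]_y (U y)%:E <= (U z - c * U z `^ (1 - alpha) + b)%:E)%E.
Hypothesis U_init : (\int[mu]_z (U z)%:E <= m%:E)%E.

(** The exponent for which the slope U^(eta - 1) times the drift U^(1 - alpha) is exactly U^s. *)
Let eta := s + alpha.

Let eta01 : 0 < eta < 1. 
Proof. by rewrite /eta ltr_wpDl//= -ltrBrDr. Qed.

Let Upos z : 0 < U z.
Proof. exact: lt_le_trans (U1 z). Qed.

(** The added 1 and the condition lam U^eta <= 1 confine the values to [1, 2]; both ends are used in
    [weight_step]. *)
Definition lyapunov (lam : R) (z : Z) : R := 1 + lam * U z `^ eta.

Lemma measurable_lyapunov lam : measurable_fun setT (lyapunov lam).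
Proof.
apply: measurable_funD => //; apply: measurable_funM => //.
by apply: (measurableT_comp (measurable_powR eta)).
Qed.

Lemma lyapunov_ge1 lam z : 0 <= lam -> 1 <= lyapunov lam z.
Proof. by move=> l0; rewrite lerDl mulr_ge0// powR_ge0. Qed.

(* The tangent line of the concave function x^eta at U z turns the drift of U into
   a drift of U^eta. *)
Lemma lyapunov_drift lam n z : 0 <= lam ->
  (\int[K n z]_y (lyapunov lam y)%:E <=
   (lyapunov lam z - lam * eta * c * U z `^ s + lam * eta * b)%:E)%E.
Proof.
move=> lam0; have /andP[e0 e1] := eta01.
set v := U z; have v0 : 0 < v by exact: Upos.
(* [g] is v^(eta - 1), so [eta * g] is the slope of x^eta at v. It is at most 1 because v >= 1, so
   it does not amplify the constant [b]. *)
pose g := v `^ eta / v.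
have vs : v `^ (1 - alpha) * g = v `^ s.
  rewrite /g -{3}(powRr1 (ltW v0)) -powR_inv1 ?powR_ge0//.
  rewrite -[v `^ 1]/(v `^ 1) -powRrM mulrN1 -!powRD ?(gt_eqF v0) ?implybT//.
  by congr (_ `^ _); rewrite /eta; lra.
have g0 : 0 <= g by rewrite /g divr_ge0// ?powR_ge0// ltW.
have g1 : g <= 1.
  by rewrite /g ler_pdivrMr// mul1r -{2}(powRr1 (ltW v0)) ler_powR ?U1// ltW.
(* [A + B * U y] is the tangent line at [v] of 1 + lam x^eta, evaluated at [U y]. *)
pose A := 1 + lam * (v `^ eta * (1 - eta)).
pose B := lam * eta * g.
have A0 : 0 <= A.
  by rewrite /A addr_ge0// mulr_ge0// mulr_ge0 ?powR_ge0// subr_ge0 ltW.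
have B0 : 0 <= B by rewrite /B mulr_ge0// mulr_ge0// ltW.
apply: (@le_trans _ _ (\int[K n z]_y (A%:E + B%:E * (U y)%:E))%E).
  apply: ge0_le_integral => //=.
  - by move=> y _; rewrite lee_fin (le_trans ler01)// lyapunov_ge1.
  - by apply/measurable_EFinP; exact: measurable_lyapunov.
  - apply: emeasurable_funD => //; apply: measurable_funeM.
    exact/measurable_EFinP.
  - move=> y _; rewrite -EFinM -EFinD lee_fin /lyapunov /A /B -!addrA lerD2l.
    have := ler_wpM2l lam0 (powR_tangent eta01 v0 (ltW (Upos y))).
    move=> /le_trans; apply; rewrite -/g.
    have -> : v `^ eta = g * v by rewrite /g divfK// gt_eqF.
    by rewrite le_eqVlt; apply/orP; left; apply/eqP; ring.
rewrite ge0_integralD//=; last 2 first.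
- by move=> y _; rewrite -EFinM lee_fin mulr_ge0// ltW.
- by apply: measurable_funeM; exact/measurable_EFinP.
rewrite integral_cst// prob_kernel mule1.
rewrite ge0_integralZl_EFin//=; last 2 first.
- by move=> y _; rewrite lee_fin ltW.
- exact/measurable_EFinP.
apply: (@le_trans _ _ (A%:E + B%:E * (v - c * v `^ (1 - alpha) + b)%:E)%E).
  by rewrite leeD// lee_wpmul2l.
rewrite -EFinM -EFinD lee_fin /A /B /lyapunov -/v -vs.
have -> : v `^ eta = g * v by rewrite /g divfK// gt_eqF.
have : lam * eta * b * g <= lam * eta * b.
  by rewrite ler_piMr// !mulr_ge0// ltW.
lra.
Qed.

(** Only times strictly before [n] are constrained, so [below v0 n.+1] is already determined by the
    past at time [n]. *)
Fixpoint below (v0 : R) (n : nat) (w : nat -> Z) : bool :=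
  if n is n'.+1 then below v0 n' w && (U (w n') <= v0) else true.

Definition power_sum (n : nat) (w : nat -> Z) : R :=
  \sum_(0 <= i < n) U (w i) `^ s.

Lemma measurable_below v0 n k : (n <= k.+1)%N ->
  measurable_fun setT (below v0 n : past_space Z k -> bool).
Proof.
elim: n => [|n IH] nk /=; first exact: measurable_cst.
apply: measurable_and; first exact: IH (ltnW nk).
apply: measurable_fun_ler => //.
by apply: measurableT_comp mU _; exact: measurable_coord_past.
Qed.

Lemma measurable_power_sum n k : (n <= k.+1)%N ->
  measurable_fun setT (power_sum n : past_space Z k -> R).
Proof.
elim: n => [|n IH] nk.
  rewrite (_ : power_sum 0 = cst 0)//.
  by apply/funext => w; rewrite /power_sum big_nil.
rewrite (_ : power_sum n.+1 = power_sum n \+ (fun w => U (w n) `^ s)); last first.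
  by apply/funext => w; rewrite /power_sum big_nat_recr.
have mn := IH (ltnW nk).
apply: (@measurable_funD _ (past_space Z k)) => //.
apply: (measurableT_comp (measurable_powR s)).
by apply: measurableT_comp mU _; exact: measurable_coord_past.
Qed.

(** After an exceedance the value is reset to [v0] instead of keeping the overshoot: the mean still
    grows at most linearly, and the value equals [v0] wherever [below] fails. *)
Definition stopped (v0 : R) (n : nat) (w : nat -> Z) : R :=
  if below v0 n w then U (w n) else v0.

Lemma stopped_ge0 v0 n w : 0 <= v0 -> 0 <= stopped v0 n w.
Proof. by move=> v00; rewrite /stopped; case: ifP => // _; exact: ltW. Qed.

Lemma measurable_stopped v0 n :
  measurable_fun setT (stopped v0 n : past_space Z n -> R).
Proof.
apply: measurable_fun_ifT => //; first exact: measurable_below.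
by apply: measurableT_comp mU _; exact: measurable_coord_past.
Qed.

(** While [U] stays below the level, the drift adds at most [b]; an exceedance is followed by a drop
    to [v0]. Markov's inequality then gives the maximal inequality for [U]. *)
Lemma stopped_mean v0 n : 0 <= v0 ->
  (\int[Pr]_w (stopped v0 n w)%:E <= (m + b * n%:R)%:E)%E.
Proof.
move=> v00; elim: n => [|n IH].
  rewrite mulr0 addr0 (chain_init law (phi := EFin \o U))//.
    exact/measurable_EFinP.
  by move=> z; rewrite lee_fin ltW.
pose G (z : past_space Z n * Z) : R := if below v0 n.+1 z.1 then U z.2 else v0.
apply: (@le_trans _ _ (\int[Pr]_w ((stopped v0 n w)%:E + b%:E))%E).
  apply: (chain_step_le law (G := EFin \o G)
    (F := fun w => ((stopped v0 n w)%:E + b%:E)%E)).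
  - apply/measurable_EFinP; apply: measurable_fun_ifT => //.
    + by apply: (measurableT_comp (measurable_below v0 (leqnn n.+1))).
    + exact: measurableT_comp.
  - by move=> z; rewrite lee_fin /G; case: ifP => // _; exact: ltW.
  - apply: emeasurable_funD => //; apply/measurable_EFinP.
    exact: measurable_stopped.
  - move=> w; rewrite /G /stopped /=.
    case: (boolP (below v0 n w && (U (w n) <= v0))) => [/andP[-> _]|].
      apply: (le_trans (U_drift n (w n))); rewrite -EFinD lee_fin lerD2r gerBl.
      by rewrite mulr_ge0 ?powR_ge0// ltW.
    rewrite negb_and -ltNge integral_cst// prob_kernel mule1.
    rewrite -EFinD lee_fin.
    case: ifPn => /= _; last by rewrite lerDl.
    by move=> Uv; rewrite (le_trans (ltW Uv))// lerDl.
have mS := measurable_of_past (@measurable_stopped v0 n).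
rewrite ge0_integralD//=; last 2 first.
- by move=> w _; rewrite lee_fin stopped_ge0.
- exact/measurable_EFinP.
rewrite (_ : (\int[Pr]_x b%:E = b%:E)%E); last first.
  by rewrite integral_cst// [X in (_ * X)%E]probability_setT mule1.
by rewrite (le_trans (leeD IH (lexx _)))// -EFinD lee_fin -natr1; lra.
Qed.

(** The rate is half of that in [lyapunov_drift]: the other half is lost in dividing by a Lyapunov
    value that can reach 2. Setting the weight to 0 after an exceedance keeps that value at most 2
    wherever it matters. *)
Definition weight (lam v0 : R) (n : nat) (w : nat -> Z) : R :=
  if below v0 n w then
    expR (lam * eta * c / 2 * power_sum n w - lam * eta * b * n%:R)
  else 0.

Lemma weight_ge0 lam v0 n w : 0 <= weight lam v0 n w.
Proof. by rewrite /weight; case: ifP => // _; exact: expR_ge0. Qed.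

Lemma measurable_weight lam v0 n k : (n <= k.+1)%N ->
  measurable_fun setT (weight lam v0 n : past_space Z k -> R).
Proof.
move=> nk; apply: measurable_fun_ifT => //; first exact: measurable_below.
apply: measurableT_comp => //; apply: measurable_funB => //.
by apply: measurable_funM => //; exact: measurable_power_sum.
Qed.

Lemma weight_step lam v0 n w : 0 <= lam -> lam * v0 `^ eta <= 1 ->
  weight lam v0 n.+1 w *
    (lyapunov lam (w n) - lam * eta * c * U (w n) `^ s + lam * eta * b) <=
  weight lam v0 n w * lyapunov lam (w n).
Proof.
move=> lam0 lamv0; have /andP[e0 e1] := eta01.
rewrite /weight /=; case: below; rewrite /= ?mul0r//.
case: ifPn => [Uv|_]; last first.
  rewrite mul0r mulr_ge0 ?expR_ge0// (le_trans ler01)//.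
  exact: lyapunov_ge1.
have h1 := lyapunov_ge1 (w n) lam0.
have h2 : lyapunov lam (w n) <= 2.
  rewrite /lyapunov -[leRHS](_ : 1 + 1 = _)// lerD2l (le_trans _ lamv0)//.
  by rewrite ler_wpM2l// ge0_ler_powR ?nnegrE// ltW// (lt_le_trans _ Uv).
have -> : lam * eta * c / 2 * power_sum n.+1 w - lam * eta * b * n.+1%:R =
    (lam * eta * c / 2 * power_sum n w - lam * eta * b * n%:R) -
    (lam * eta * b - lam * eta * c / 2 * U (w n) `^ s).
  by rewrite /power_sum big_nat_recr//= -natr1; ring.
rewrite expRB -mulrA ler_wpM2l ?expR_ge0//.
rewrite mulrC ler_pdivrMr ?expR_gt0//.
(* With h in [1, 2] the Lyapunov value, A the gain and B the loss, exp (B - A/2) >= 1 + B - A/2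
   leaves h - A + B <= h (1 + B - A/2), where B <= h B and h A/2 <= A. *)
apply: le_trans (ler_wpM2l (le_trans ler01 h1) (expR_ge1Dx _)).
have : 0 <= lam * eta * b by rewrite !mulr_ge0// ltW.
have : 0 <= lam * eta * c * U (w n) `^ s.
  by rewrite !mulr_ge0 ?powR_ge0// ltW.
move: (lyapunov _ _) h1 h2 (lam * eta * b) => h h1 h2 B X B0.
have -> : lam * eta * c / 2 * U (w n) `^ s = (lam * eta * c * U (w n) `^ s) / 2.
  by ring.
move: (lam * eta * c * U (w n) `^ s) X => A A0.
nra.
Qed.

(** [weight] at [n.+1] depends only on the past at [n], so it leaves the conditional expectation;
    [lyapunov_drift] and [weight_step] then show that the mean does not increase. Initially U^eta <=
    U. *)
Lemma weight_mean lam v0 n : 0 <= lam -> lam * v0 `^ eta <= 1 ->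
  (\int[Pr]_w (weight lam v0 n w * lyapunov lam (w n))%:E <=
   (1 + lam * m)%:E)%E.
Proof.
move=> lam0 lamv0.
have lyap0 z : 0 <= lyapunov lam z by rewrite (le_trans ler01)// lyapunov_ge1.
elim: n => [|n IH].
  under eq_integral do
    rewrite /weight /= /power_sum big_nil !mulr0 subrr expR0 mul1r.
  rewrite (chain_init law (phi := EFin \o lyapunov lam)); last 2 first.
  - by apply/measurable_EFinP; exact: measurable_lyapunov.
  - by move=> z; rewrite lee_fin.
  apply: (@le_trans _ _ (\int[mu]_z (1 + lam%:E * (U z)%:E))%E).
    apply: ge0_le_integral => //=.
    - by move=> z _; rewrite lee_fin.
    - by apply/measurable_EFinP; exact: measurable_lyapunov.
    - apply: emeasurable_funD => //; apply: measurable_funeM.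
      exact/measurable_EFinP.
    - move=> z _; rewrite -EFinM -EFinD lee_fin lerD2l ler_wpM2l//.
      by rewrite -[leRHS]powRr1 ?ler_powR ?U1// ltW//; case/andP: eta01.
  rewrite ge0_integralD//=; last 2 first.
  - by move=> z _; rewrite -EFinM lee_fin mulr_ge0// ltW.
  - by apply: measurable_funeM; exact/measurable_EFinP.
  have mu1 : mu setT = 1%E by rewrite -(law.1 _ measurableT) probability_setT.
  rewrite integral_cst// mu1 mule1 EFinD leeD2l// ge0_integralZl_EFin//.
  - by rewrite EFinM lee_wpmul2l.
  - by move=> z _; rewrite lee_fin ltW.
  - exact/measurable_EFinP.
pose G (z : past_space Z n * Z) : R := weight lam v0 n.+1 z.1 * lyapunov lam z.2.
apply: le_trans IH.
apply: (chain_step_le law (G := EFin \o G)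
    (F := fun w => (weight lam v0 n w * lyapunov lam (w n))%:E)).
- apply/measurable_EFinP; apply: measurable_funM.
    exact: measurableT_comp (measurable_weight lam v0 (leqnn n.+1)) _.
  by apply: measurableT_comp => //; exact: measurable_lyapunov.
- by move=> z; rewrite lee_fin mulr_ge0// weight_ge0.
- apply/measurable_EFinP; apply: measurable_funM.
    exact: measurable_weight.
  apply: (measurableT_comp (measurable_lyapunov lam)).
  exact: measurable_coord_past.
- move=> w; rewrite /G /=; under eq_integral do rewrite EFinM.
  rewrite ge0_integralZl_EFin ?weight_ge0//; last 2 first.
  + by move=> z _; rewrite lee_fin.
  + by apply/measurable_EFinP; exact: measurable_lyapunov.
  apply: (le_trans (lee_wpmul2l _ (lyapunov_drift n (w n) lam0))).
    by rewrite lee_fin weight_ge0.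
  by rewrite -EFinM lee_fin weight_step.
Qed.

Let measurable_event n (E : (nat -> Z) -> bool) :
  measurable_fun setT (E : past_space Z n -> bool) ->
  measurable ([set w | E w] : set (path_space Z)).
Proof.
by move=> mE; have := measurable_of_past mE measurableT (Logic.I : measurable [set true]);
  rewrite setTI.
Qed.

(* Either U exceeds v0 before time n, or the stopped weight is exponentially large. *)
Lemma power_sum_tail lam v0 n : 0 < lam -> lam <= 1 -> 0 < v0 ->
  lam * v0 `^ eta <= 1 ->
  (Pr [set w | (2 * (b + 1) / c * n%:R < power_sum n w)%R] <=
   ((m + b * n%:R) / v0 + (1 + m) * expR (- (lam * eta * n%:R)))%:E)%E.
Proof.
move=> lam0 lam1 v00 lamv0.
have mb : measurable_fun setT (below v0 n : past_space Z n -> bool).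
  exact: measurable_below.
have mps : measurable_fun setT
    ((fun w => 2 * (b + 1) / c * n%:R < power_sum n w) : past_space Z n -> bool).
  by apply: measurable_fun_ltr => //; exact: measurable_power_sum.
have mE1 : measurable ([set w | ~~ below v0 n w] : set (path_space Z)).
  by apply: (@measurable_event n (fun w => ~~ below v0 n w)); exact: measurable_neg.
have mE2 : measurable ([set w | below v0 n w &&
    (2 * (b + 1) / c * n%:R < power_sum n w)] : set (path_space Z)).
  by apply: (@measurable_event n) => //; exact: measurable_and.
have mE := @measurable_event n _ mps.
have P1 : (Pr [set w | ~~ below v0 n w] <= ((m + b * n%:R) / v0)%:E)%E.
  apply: (@markov_le _ _ _ Pr (stopped v0 n) v0 (m + b * n%:R) _ mE1) => //.
  - exact: measurable_of_past (@measurable_stopped v0 n).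
  - by move=> w; apply: stopped_ge0; exact: ltW.
  - by move=> w /= /negbTE; rewrite /stopped => ->.
  - by apply: stopped_mean; exact: ltW.
have P2 : (Pr [set w | below v0 n w && (2 * (b + 1) / c * n%:R < power_sum n w)%R]
    <= ((1 + lam * m) / expR (lam * eta * n%:R))%:E)%E.
  apply: (@markov_le _ _ _ Pr (fun w => weight lam v0 n w * lyapunov lam (w n))
    (expR (lam * eta * n%:R)) (1 + lam * m) _ mE2) => //.
  - have mw : measurable_fun setT (weight lam v0 n : past_space Z n -> R).
      exact: measurable_weight.
    apply: (@measurable_funM _ (path_space Z)); first exact: measurable_of_past mw.
    apply: (measurableT_comp (measurable_lyapunov lam)); exact: measurable_coord.
  - move=> w; rewrite mulr_ge0 ?weight_ge0// (le_trans ler01)// lyapunov_ge1//.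
    exact: ltW.
  - exact: expR_gt0.
  - move=> w /= /andP[bw Sw]; rewrite /weight bw.
    apply: (@le_trans _ _ (expR (lam * eta * n%:R) * 1)); first by rewrite mulr1.
    rewrite ler_pM ?expR_ge0//; last by apply: lyapunov_ge1; exact: ltW.
    (* The threshold 2 (b + 1) / c makes the gain at least lam eta (b + 1) n, which exceeds the loss
       lam eta b n by lam eta n. *)
    rewrite ler_expR -subr_ge0.
    have -> : lam * eta * c / 2 * power_sum n w - lam * eta * b * n%:R -
        lam * eta * n%:R = lam * eta * c / 2 *
      (power_sum n w - 2 * (b + 1) / c * n%:R) by field; rewrite gt_eqF.
    rewrite mulr_ge0// ?subr_ge0 ?(ltW Sw)// !mulr_ge0// ltW//.
    by case/andP: eta01.
  - by apply: weight_mean => //; exact: ltW.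
rewrite EFinD; apply: (le_trans _ (leeD P1 (le_trans P2 _))).
  apply: (le_trans _ (measureU2 _ mE1 mE2)); apply: le_measure; rewrite ?inE//.
    exact: measurableU.
  move=> w /= Sw; case: (boolP (below v0 n w)) => bw; [right|left] => //=.
rewrite lee_fin expRN ler_wpM2r ?invr_ge0 ?expR_ge0// lerD2l.
by rewrite ler_piMl.
Qed.

Lemma power_sum_bound :
  {ae Pr, forall w, \forall n \near \oo,
    power_sum n w <= 2 * (2 * (b + 1) / c) * n%:R}.
Proof.
have /andP[e0 e1] := eta01.
(* Any r between eta and 1 would do: q > 1 makes the level N^q superlinear, r < 1 makes lam N = N^(1
   - r) diverge, and lam times the level to the power eta is exactly 1. *)
pose r := (1 + eta) / 2; pose q := r / eta.
have r1 : r < 1 by rewrite /r; lra.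
have r0 : 0 < r by rewrite /r; lra.
have q1 : 1 < q by rewrite /q ltr_pdivlMr// /r; lra.
have q0 : 0 < q by lra.
pose Kc : R := 2 * (b + 1) / c.
have Kc0 : 0 <= Kc by rewrite /Kc divr_ge0 ?mulr_ge0// ?addr_ge0// ltW.
pose N j : R := (2 ^ j)%:R.
pose E j : set (path_space Z) :=
  [set w | (Kc * N j < power_sum (2 ^ j)%N w)%R].
have mE j : measurable (E j).
  apply: (@measurable_event (2 ^ j)%N
    (fun w => Kc * N j < power_sum (2 ^ j)%N w)).
  by apply: measurable_fun_ltr => //; exact: measurable_power_sum.
pose r1' : R := 2 `^ (1 - q); pose r2' : R := 2 `^ (r - 1).
have r1'01 : 0 <= r1' < 1 by apply: powR2_lt1; lra.
have r2'01 : 0 <= r2' < 1 by apply: powR2_lt1; lra.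
have PE j : (Pr (E j) <= ((m + b) * r1' ^+ j + (1 + m) / eta * r2' ^+ j)%:E)%E.
  have N1 : 1 <= N j by rewrite ler1n expn_gt0.
  have N0 : 0 < N j by lra.
  apply: (le_trans (@power_sum_tail (N j `^ (- r)) (N j `^ q) (2 ^ j)%N _ _ _ _)).
  - exact: powR_gt0.
  - by rewrite -[leRHS](powRr0 (N j)) ler_powR// oppr_le0 ltW.
  - exact: powR_gt0.
  - rewrite -powRrM /q divfK ?gt_eqF// -powRD ?(gt_eqF N0) ?implybT//.
    by rewrite addNr powRr0.
  rewrite lee_fin lerD//.
    rewrite -powR_expn2 -/(N j) powRB ?(gt_eqF N0) ?implybT//.
    rewrite powRr1 ?(ltW N0)// mulrA ler_wpM2r ?invr_ge0 ?powR_ge0//.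
    by rewrite mulrDl lerD2r ler_peMr.
  rewrite -[leRHS]mulrA ler_wpM2l ?addr_ge0//.
  rewrite -powR_expn2 -/(N j).
  have X0 : 0 < eta * N j `^ (1 - r) by rewrite mulr_gt0// powR_gt0.
  have -> : N j `^ (- r) * eta * N j = eta * N j `^ (1 - r).
    by rewrite mulrAC mulrC addrC powRD ?(gt_eqF N0) ?implybT// powRr1 ?(ltW N0).
  have -> : eta^-1 * N j `^ (r - 1) = (eta * N j `^ (1 - r))^-1.
    by rewrite invfM -powRN opprB.
  (* The crude bound exp (- x) <= 1 / x suffices, since N^(r - 1) is geometric along N = 2^j. *)
  rewrite expRN lef_pV2 ?posrE ?expR_gt0//.
  by rewrite (le_trans _ (expR_ge1Dx _))// lerDr.
have H := @ae_cvg0_summable _ _ _ Pr (fun j => \1_(E j))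
  (fun j => (m + b) * r1' ^+ j + (1 + m) / eta * r2' ^+ j)
  ((m + b) / (1 - r1') + (1 + m) / eta / (1 - r2')).
apply: ae_mono (H _ _ _ _).
(* An indicator that tends to 0 is eventually 0, so only finitely many of the events [E j] occur. *)
- move=> w /cvgrPdist_lt /(_ _ ltr01) [J _ HJ].
  apply: (@average_dyadic _ (power_sum^~ w) Kc) => //.
    apply/nondecreasing_seqP => n; rewrite /power_sum big_nat_recr//= lerDl.
    exact: powR_ge0.
  exists J => // j /HJ /=; rewrite sub0r normrN.
  rewrite indicE; case: (boolP (w \in E j)) => [_|].
    by rewrite normr1 ltxx.
  by move=> /negP wE _; rewrite leNgt; apply/negP => h; apply: wE; rewrite inE.
- by move=> j; exact: measurable_indic.
- by move=> j w; rewrite indicE ler0n.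
- by move=> j; rewrite integral_indic// setIT; exact: PE.
- move=> n; rewrite big_split/= -!mulr_sumr lerD// ler_wpM2l ?geometric_sum_le//.
    exact: addr_ge0.
  by rewrite divr_ge0 ?addr_ge0// ltW.
Qed.

End drift.

(** * Freezing the adaptation parameter *)

Section ereal_tools.
Context {R : realType}.

Lemma sup_ge0_ub (S : set (\bar R)) y : S y -> y <= sup_ge0 S.
Proof. by move=> Sy; apply: ereal_sup_ubound; right. Qed.

Lemma sup_ge0_ge0 (S : set (\bar R)) : 0 <= sup_ge0 S.
Proof. by apply: ereal_sup_ubound; left. Qed.

Lemma cvge0_lt (u : nat -> \bar R) (e : R) : (0 < e)%R ->
  u n @[n --> \oo] --> 0 -> \forall n \near \oo, u n < e%:E.
Proof.
by move=> e0 u0; apply: (u0 (fun y => y < e%:E)); apply: open_ereal_lt'; rewrite lte_fin.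
Qed.

(** Replaces an event of unknown measurability by a measurable one, over which expectations can be
    split. *)
Lemma outer_prob_cover d (T : measurableType d) (Pr : probability T R)
    (A : set T) (e : R) : outer_prob Pr A < e%:E ->
  exists2 B, measurable B & A `<=` B /\ Pr B <= e%:E.
Proof.
move=> /ereal_inf_lt[_ [F [mF AF] <-] Fe].
exists (\bigcup_k F k); first exact: bigcup_measurable.
split => //; apply: le_trans (ltW Fe).
by apply: measure_sigma_subadditive => //; exact: bigcup_measurable.
Qed.

Lemma integral_mkcomp_noparam d0 d1 d2 (T0 : measurableType d0)
    (T1 : measurableType d1) (T2 : measurableType d2)
    (k1 : R.-spker T0 ~> T1) (k2 : R.-spker T1 ~> T2) x (f : T2 -> \bar R) :
  (forall z, 0 <= f z) -> measurable_fun setT f ->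
  \int[mkcomp_noparam k1 k2 x]_z f z = \int[k1 x]_y \int[k2 y]_z f z.
Proof. exact: (integral_kcomp k1 (kernel.kernel_snd k2) x). Qed.

End ereal_tools.

Section adaptation.
Context {R : realType} {dX dT : measure_display} {X : measurableType dX}
  {Theta : measurableType dT}.
Variables (P : Theta -> R.-pker X ~> X)
  (Pbar : nat -> R.-pker (X * Theta)%type ~> (X * Theta)%type).
Hypothesis Pbar_P : forall (n : nat) (x : X) (theta : Theta) (A : set X),
  measurable A -> Pbar n (x, theta) (A `*` setT) = P theta x A.

Lemma integral_Pbar_fst n z (g : X -> \bar R) :
  measurable_fun setT g -> (forall x, 0 <= g x) ->
  \int[Pbar n z]_y g y.1 = \int[P z.2 z.1]_x g x.
Proof.
move=> mg g0.
transitivity (\int[pushforward (Pbar n z) fst]_x g x).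
  by rewrite ge0_integral_pushforward// preimage_setT.
apply: eq_measure_integral => A mA _.
rewrite -(Pbar_P n z.1 z.2 mA) -surjective_pairing; congr (Pbar n z _).
by apply/seteqP; split => [y|y []].
Qed.

Local Open Scope ring_scope.
Variables (g : X -> R) (ug : unit_fun g).

(* frozen m (x, theta) = P_theta^m g (x). It is defined through Pbar because only
   Pbar 0 is known to be jointly measurable. *)
Fixpoint frozen (m : nat) (z : X * Theta) : R :=
  if m is m'.+1 then \int[Pbar 0 z]_y frozen m' (y.1, z.2) else g z.1.

Lemma frozen_unit m : unit_fun (frozen m).
Proof.
elim: m => [|m [mm m01]] /=.
  by split => [|z]; [apply: measurableT_comp => //; case: ug|exact: ug.2].
have mpair : measurable_fun setT
    (fun zy : (X * Theta) * (X * Theta) => (zy.2.1, zy.1.2)).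
  apply: measurable_fun_pair.
    by apply: measurableT_comp => //; exact: measurableT_comp.
  by apply: measurableT_comp => //; exact: measurableT_comp.
split.
  apply: measurableT_comp => //.
  apply: (@measurable_fun_integral_finite_kernel _ _ _ _ R
    (fun zy => (frozen m (zy.2.1, zy.1.2))%:E) (Pbar 0)).
    by move=> zy; rewrite lee_fin; case/andP: (m01 (zy.2.1, zy.1.2)).
  by apply/measurable_EFinP; exact: measurableT_comp mm mpair.
move=> z; apply: unit_fun_Rintegral01; first exact: prob_kernel.
split => // ; apply: (measurableT_comp (f := frozen m)) => //.
by apply: measurable_fun_pair.
Qed.

Lemma frozen_section m theta : unit_fun (fun x => frozen m (x, theta)).
Proof.
have [mm m01] := frozen_unit m; split => //.
exact: measurableT_comp mm (measurable_pair2 theta).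
Qed.

(** The integrand sees only the X-component, whose law is [P] at the current parameter for every
    kernel [Pbar n]; this is why [Pbar 0] could be used in the definition. *)
Lemma frozenS n m z :
  (\int[Pbar n z]_y (frozen m (y.1, z.2))%:E = (frozen m.+1 z)%:E)%E.
Proof.
have u := frozen_section m z.2.
have H k := integral_Pbar_fst k z (g := fun x => (frozen m (x, z.2))%:E).
rewrite H; last 2 first.
- by apply/measurable_EFinP; case: u.
- by move=> x; rewrite lee_fin; case/andP: (u.2 x).
rewrite /= /Rintegral H; last 2 first.
- by apply/measurable_EFinP; case: u.
- by move=> x; rewrite lee_fin; case/andP: (u.2 x).
by rewrite -(unit_fun_RintegralE _ u)//; exact: prob_kernel.
Qed.

Lemma frozenSE m x theta :
  frozen m.+1 (x, theta) = \int[P theta x]_y frozen m (y, theta).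
Proof.
have u := frozen_section m theta.
apply: EFin_inj; rewrite -(frozenS 0).
rewrite (integral_Pbar_fst 0 (x, theta) (g := fun x => (frozen m (x, theta))%:E)).
- by rewrite -(unit_fun_RintegralE _ u)//; exact: prob_kernel.
- by apply/measurable_EFinP; case: u.
- by move=> y; rewrite lee_fin; case/andP: (u.2 y).
Qed.

Lemma frozen_kiter m x theta :
  (\int[kiter (P theta) m x]_y (g y)%:E = (frozen m (x, theta))%:E)%E.
Proof.
have mg : measurable_fun setT (EFin \o g) by apply/measurable_EFinP; case: ug.
elim: m x => [|m IH] x.
  by rewrite /= /kdirac integral_dirac// diracT mul1e.
rewrite [kiter _ _]/= integral_mkcomp_noparam//; last first.
  by move=> z; rewrite lee_fin; case/andP: (ug.2 z).
under eq_integral do rewrite IH.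
rewrite frozenSE -(unit_fun_RintegralE _ (frozen_section m theta))//.
exact: prob_kernel.
Qed.

Lemma kernel_dist_bound (h : X -> R) t t' x (e : R) : unit_fun h ->
  (kernel_dist P t t' < e%:E)%E ->
  `| \int[P t x]_y h y - \int[P t' x]_y h y | <= e.
Proof.
move=> uh De; have [mh h01] := uh.
rewrite -lee_fin; apply: le_trans (ltW De).
apply: (@le_trans _ _ (tv_sub (P t x) (P t' x))); last first.
  by apply: sup_ge0_ub; exists x.
apply: sup_ge0_ub; exists h => /=.
  by split => // y; have /andP[h0 h1] := h01 y; rewrite divr1 ger0_norm.
rewrite -!(unit_fun_RintegralE _ uh)//; exact: prob_kernel.
Qed.

(** P_t^(m+1) - P_t'^(m+1) = P_t (P_t^m - P_t'^m) + (P_t - P_t') P_t'^m, and each step costs at most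
    [e]. *)
Lemma frozen_dist m t t' x (e : R) : (kernel_dist P t t' < e%:E)%E ->
  `| frozen m (x, t) - frozen m (x, t') | <= m%:R * e.
Proof.
move=> De; elim: m x => [|m IH] x; first by rewrite subrr normr0 mul0r.
rewrite !frozenSE.
have Pt1 : P t x setT = 1%E by exact: prob_kernel.
have it := unit_fun_integrable Pt1 (frozen_section m t).
have it' := unit_fun_integrable Pt1 (frozen_section m t').
rewrite -(subrKA (\int[P t x]_y frozen m (y, t'))) (le_trans (ler_normD _ _))//.
rewrite -natr1 mulrDl mul1r lerD//; last exact: kernel_dist_bound (frozen_section m t') De.
rewrite -RintegralB//; apply: (le_trans (le_normr_Rintegral _ _)) => //.
  exact: (integrableB measurableT it it').
apply: (@le_trans _ _ (\int[P t x]_y (m%:R * e))).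
  apply: le_Rintegral => //.
  - by apply: integrable_norm; exact: (integrableB measurableT it it').
  - by apply: (bounded_integrable (B := `|m%:R * e|)).
by rewrite Rintegral_cst// Pt1 mulr1.
Qed.

Section telescoping.
Variables (l : nat) (mu : {measure set (X * Theta) -> \bar R})
  (Pr : probability (path_space (X * Theta)%type) R).
Hypothesis law : is_chain_law (fun n => Pbar (l + n)) mu Pr.

Let Pr1 : Pr setT = 1%E. Proof. exact: probability_setT. Qed.

Lemma frozen_coord_unit m n :
  unit_fun ((fun w => frozen m (w n)) : path_space (X * Theta)%type -> R).
Proof.
have [mm m01] := frozen_unit m; split => //.
by apply: measurableT_comp mm _; exact: measurable_coord.
Qed.

Lemma frozen_mixed_unit m j : unit_fun ((fun w => frozen m ((w j.+1).1, (w j).2))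
  : path_space (X * Theta)%type -> R).
Proof.
have [mm m01] := frozen_unit m; split => //.
apply: (measurableT_comp mm); apply: measurable_fun_pair.
  by apply: measurableT_comp => //; exact: measurable_coord.
by apply: measurableT_comp => //; exact: measurable_coord.
Qed.

(** Given the past, X_(j+1) has law P_(theta_j) (X_j, .): keeping theta_j while moving X is exactly
    one frozen step. *)
Lemma frozen_mixed m j :
  \int[Pr]_w frozen m.+1 (w j) = \int[Pr]_w frozen m ((w j.+1).1, (w j).2).
Proof.
apply: EFin_inj; rewrite !unit_fun_RintegralE//; last 2 first.
- exact: frozen_mixed_unit.
- exact: frozen_coord_unit.
have [mm m01] := frozen_unit m.
rewrite (chain_step law (n := j)
  (G := fun z => (frozen m (z.2.1, (z.1 j).2))%:E)).
- by apply: eq_integral => w _; rewrite -(frozenS (l + j)).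
- apply/measurable_EFinP; apply: (measurableT_comp mm).
  apply: measurable_fun_pair; first exact: measurableT_comp.
  apply: measurableT_comp => //.
  exact: measurableT_comp (measurable_coord_past (leqnn j)) _.
- by move=> z; rewrite lee_fin; case/andP: (m01 (z.2.1, (z.1 j).2)).
Qed.

(** After [frozen_mixed] both integrands sit at X_(j+1), one with theta_(j+1) and one with theta_j.
    They differ by at most m e off [B] and by at most 1 on [B]. *)
Lemma frozen_step m j (B : set (path_space (X * Theta)%type)) (e dl : R) :
  measurable B -> (Pr B <= dl%:E)%E -> 0 <= e ->
  (forall w, ~ B w -> (kernel_dist P (w j.+1).2 (w j).2 < e%:E)%E) ->
  `| \int[Pr]_w frozen m (w j.+1) - \int[Pr]_w frozen m.+1 (w j) | <= m%:R * e + dl.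
Proof.
move=> mB PB e0 Be; rewrite frozen_mixed.
have i1 := unit_fun_integrable Pr1 (frozen_coord_unit m j.+1).
have i2 := unit_fun_integrable Pr1 (frozen_mixed_unit m j).
have iB : Pr.-integrable setT (EFin \o (\1_B : path_space (X * Theta)%type -> R)).
  by apply: unit_fun_integrable => //; split => // w; rewrite indicE; case: (w \in B);
    rewrite ?lexx ler01.
have ic : Pr.-integrable setT (EFin \o cst (m%:R * e)).
  by apply: (bounded_integrable (B := `|m%:R * e|)).
rewrite -RintegralB//; apply: (le_trans (le_normr_Rintegral _ _)) => //.
  exact: (integrableB measurableT i1 i2).
apply: (@le_trans _ _ (\int[Pr]_w (m%:R * e + \1_B w))).
  apply: le_Rintegral => //.
  - by apply: integrable_norm; exact: (integrableB measurableT i1 i2).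
  - exact: (integrableD measurableT ic iB).
  move=> w _; rewrite indicE; case: (boolP (w \in B)) => wB.
    have /andP[? ?] := (frozen_coord_unit m j.+1).2 w.
    have /andP[? ?] := (frozen_mixed_unit m j).2 w.
    apply: (@le_trans _ _ 1); first by rewrite ler_norml; lra.
    by rewrite lerDr mulr_ge0.
  rewrite addr0 [w j.+1 in leLHS]surjective_pairing.
  by apply: frozen_dist; apply: Be => Bw; rewrite mem_set in wB.
rewrite RintegralD// (Rintegral_cst1 Pr1) lerD2l.
rewrite /Rintegral integral_indic// setIT -lee_fin fineK//.
by rewrite fin_num_measure.
Qed.

(** Interpolates by the mean of P_theta^(N-i) g (X) at time q + i: i = N is the adaptive chain, i =
    0 the kernel frozen at time q. *)
Lemma frozen_telescope q N (e dl : R) : 0 <= e ->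
  (forall j, (q <= j)%N -> exists2 B, measurable B & (Pr B <= dl%:E)%E /\
     (forall w, ~ B w -> (kernel_dist P (w j.+1).2 (w j).2 < e%:E)%E)) ->
  `| \int[Pr]_w frozen 0 (w (q + N)%N) - \int[Pr]_w frozen N (w q) | <=
  N%:R * (N%:R * e + dl).
Proof.
move=> e0 HB.
suff H i : (i <= N)%N ->
    `| \int[Pr]_w frozen (N - i) (w (q + i)%N) - \int[Pr]_w frozen N (w q) | <=
    i%:R * (N%:R * e + dl).
  by have := H N (leqnn N); rewrite subnn.
elim: i => [|i IH] iN; first by rewrite subn0 addn0 subrr normr0 mul0r.
rewrite -(subrKA (\int[Pr]_w frozen (N - i) (w (q + i)%N))).
rewrite (le_trans (ler_normD _ _))// -natr1 mulrDl mul1r addrC lerD//.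
  exact: IH (ltnW iN).
have [B mB [PB Be]] := HB (q + i)%N (leq_addr _ _).
rewrite addnS -(subnSK iN).
apply: (le_trans (frozen_step _ mB PB e0 Be)).
by rewrite lerD2r ler_wpM2r// ler_nat leq_subr.
Qed.

End telescoping.

Lemma transfers_shift d (Z : measurableType d) (K : nat -> R.-pker Z ~> Z) l n phi :
  transfers (fun i => K (l + i)%N) 0 n phi = transfers K l n phi.
Proof. by elim: n phi => //= n IH phi; rewrite IH. Qed.

End adaptation.

(** * Bounded functions *)

Section adaptive_lln.
Context {R : realType} {dX dT : measure_display} {X : measurableType dX}
  {Theta : measurableType dT}.
Variables (P : Theta -> R.-pker X ~> X)
  (Pbar : nat -> R.-pker (X * Theta)%type ~> (X * Theta)%type).
Hypothesis Pbar_P : forall (n : nat) (x : X) (theta : Theta) (A : set X),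
  measurable A -> Pbar n (x, theta) (A `*` setT) = P theta x A.
Variable Pr : nat -> X -> Theta -> probability (path_space (X * Theta)%type) R.
Hypothesis Pr_law : forall (l : nat) (x : X) (theta : Theta),
  is_chain_law (fun n => Pbar (l + n)%N) \d_((x, theta)) (Pr l x theta).
Variables (V : X -> R) (pi : probability X R) (beta : R).
Hypotheses (V_meas : measurable_fun setT V) (V_ge1 : forall x, (1 <= V x)%R).
Hypothesis beta_ge0 : (0 <= beta)%R.
Hypothesis ergodicity : forall d : R,
  sup_ge0 [set wnorm_sub (fun y => V y `^ beta)%R (kiter (P theta) n x) pi
           | x in [set x | (V x <= d)%R] & theta in [set: Theta]]
    @[n --> \oo] --> 0.
Hypothesis diminishing : forall (d e : R), (0 < e)%R ->
  sup_ge0 (\bigcup_l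
    [set outer_prob (Pr l x theta)
           [set w | e%:E <= kernel_dist P (w n).2 (w n.-1).2]
     | x in [set x | (V x <= d)%R] & theta in [set: Theta]])
    @[n --> \oo] --> 0.

Local Open Scope ring_scope.

Lemma V_beta_ge1 x : 1 <= V x `^ beta.
Proof. by rewrite -[leLHS](powRr0 (V x)) ler_powR. Qed.

(** As V^beta >= 1, functions with values in [0, 1] are test functions of the weighted norm. *)
Lemma ergodicity_unit (d e : R) : 0 < e -> exists N : nat,
  forall (g : X -> R) x theta, unit_fun g -> V x <= d ->
    `| frozen Pbar g N (x, theta) - \int[pi]_y g y | <= e.
Proof.
move=> e0; have [N _ HN] := cvge0_lt e0 (ergodicity d).
exists N => g x theta ug Vx; have [mg g01] := ug.
rewrite -lee_fin; apply: le_trans (ltW (HN N (leqnn N))).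
apply: le_trans (sup_ge0_ub (ex_intro2 _ _ x Vx (ex_intro2 _ _ theta Logic.I erefl))).
apply: sup_ge0_ub; exists g => /=.
  split => // y; rewrite ler_pdivrMr ?mul1r ?(lt_le_trans ltr01 (V_beta_ge1 y))//.
  have /andP[g0 g1] := g01 y.
  by rewrite ger0_norm// (le_trans g1)// V_beta_ge1.
rewrite (frozen_kiter Pbar_P ug) -(unit_fun_RintegralE _ ug)//.
exact: probability_setT.
Qed.

Lemma diminishing_cover (d e dl : R) : 0 < e -> 0 < dl -> exists q : nat,
  forall l x theta j, V x <= d -> (q <= j)%N ->
  exists2 B, measurable B & (Pr l x theta B <= dl%:E)%E /\
    (forall w, ~ B w -> (kernel_dist P (w j.+1).2 (w j).2 < e%:E)%E).
Proof.
move=> e0 dl0; have [q _ Hq] := cvge0_lt dl0 (diminishing d e0).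
exists q => l x theta j Vx qj.
(* The hypothesis compares times n and [n.-1]; n = [j.+1] yields the pair j, j + 1. *)
have Hj := Hq j.+1 (leqW qj).
have [|B mB [AB PB]] := @outer_prob_cover R _ _ (Pr l x theta)
  [set w | (e%:E <= kernel_dist P (w j.+1).2 (w j).2)%E] dl.
  apply: le_lt_trans Hj; apply: sup_ge0_ub; exists l => //.
  by exists x => //; exists theta.
exists B => //; split => // w Bw; rewrite ltNge; apply/negP => ew.
by apply: Bw; apply: AB.
Qed.

Definition above (d : R) (z : X * Theta) : R := \1_[set y : X * Theta | d < V y.1] z.

Lemma above_unit d : unit_fun (above d).
Proof.
split; last first.
  by move=> z; rewrite /above indicE; case: (_ \in _); rewrite ?lexx ler01.
have mV : measurable_fun setT (fun z : X * Theta => d < V z.1).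
  by apply: measurable_fun_ltr => //; exact: measurableT_comp.
apply: measurable_indic.
by have := mV measurableT _ (Logic.I : measurable [set true]); rewrite setTI.
Qed.

(* At lag q the adaptation has stabilised, and from then on the frozen kernel has N
   steps to come close to pi, unless V (X_q) is large. *)
Lemma transfers_close (d e : R) (g : X -> R) : 0 < e -> unit_fun g ->
  exists q N : nat, forall l z, V z.1 <= d ->
  `| transfers Pbar l (q + N) (g \o fst) z - \int[pi]_x g x | <=
  e + transfers Pbar l q (above d) z.
Proof.
move=> e0 ug; have [mg g01] := ug.
have e2 : 0 < e / 2 by rewrite divr_gt0.
have [N HN] := ergodicity_unit d e2.
(* [e'] serves both as threshold on the kernel distance and as probability of the exceptional set;
   the telescoping error N (N + 1) e' is then at most e / 4. It depends on N, so q is chosen after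
   N. *)
pose e' := e / (4 * (N.+1)%:R ^+ 2).
have NN : 0 < 4 * (N.+1)%:R ^+ 2 :> R by rewrite mulr_gt0// exprn_gt0.
have e'0 : 0 < e' by rewrite /e' divr_gt0.
have [q Hq] := diminishing_cover d e'0 e'0.
exists q, N => l [x theta] /= Vx.
have law := Pr_law l x theta.
have Pr1 : Pr l x theta setT = 1%E by exact: probability_setT.
have uf m n := frozen_coord_unit Pbar ug m n.
have E0 phi n : unit_fun phi ->
    transfers Pbar l n phi (x, theta) = \int[Pr l x theta]_w phi (w n).
  move=> uphi; apply: EFin_inj; rewrite unit_fun_RintegralE//; last first.
    have [mphi phi01] := uphi; split => //.
    by apply: measurableT_comp mphi _; exact: measurable_coord.
  rewrite (chain_transfers law)// integral_dirac//; last first.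
    by apply/measurable_EFinP; case: (transfers_unit (fun i => Pbar (l + i)%N) 0 n uphi).
  by rewrite diracT mul1e transfers_shift.
rewrite !E0; last 2 first.
- exact: above_unit.
- by split => [|z]; [exact: measurableT_comp|exact: g01].
have T := frozen_telescope Pbar_P ug law (q := q) N (ltW e'0)
  (fun j qj => Hq l x theta j Vx qj).
have N1 : 1 <= N.+1%:R :> R by rewrite ler1n.
have small : N%:R * (N%:R * e' + e') <= e / 2.
  have -> : N%:R * (N%:R * e' + e') = (N%:R * N.+1%:R) * e'.
    by rewrite -natr1; ring.
  rewrite /e' mulrA ler_pdivrMr//.
  have : N%:R <= N.+1%:R :> R by rewrite ler_nat.
  move: (N%:R : R) (N.+1%:R : R) (ler0n R N) N1 => n n1 n0 n11 nn.
  have n10 : 0 <= n1 by lra.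
  have h := ler_wpM2r (ltW e0) (ler_wpM2r n10 nn).
  have h0 : 0 <= n1 * n1 * e by rewrite !mulr_ge0// ltW.
  have -> : e / 2 * (4 * n1 ^+ 2) = 2 * (n1 * n1 * e) by field.
  lra.
have iN := unit_fun_integrable Pr1 (uf N q).
have mabove : measurable_fun setT
    ((fun w => above d (w q)) : path_space (X * Theta)%type -> R).
  by have [ma _] := above_unit d; apply: measurableT_comp ma _; exact: measurable_coord.
have ia : (Pr l x theta).-integrable setT (EFin \o (fun w => above d (w q))).
  apply: unit_fun_integrable => //; split => // w.
  exact: (above_unit d).2.
have /andP[p0 p1] := unit_fun_Rintegral01 (probability_setT pi) ug.
set p := \int[pi]_x g x in HN p0 p1 *.
have ip : (Pr l x theta).-integrable setT (EFin \o cst p).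
  by apply: (bounded_integrable (B := `|p|)).
have ie : (Pr l x theta).-integrable setT (EFin \o cst (e / 2)).
  by apply: (bounded_integrable (B := `|e / 2|)).
(* Where V (X_q) <= d, ergodicity gives e / 2; elsewhere both quantities lie in [0, 1] and [above]
   equals 1. *)
have close : `| \int[Pr l x theta]_w frozen Pbar g N (w q) - p | <=
    e / 2 + \int[Pr l x theta]_w above d (w q).
  have -> : p = \int[Pr l x theta]_w p by rewrite (Rintegral_cst1 Pr1).
  rewrite -RintegralB//; apply: (le_trans (le_normr_Rintegral _ _)) => //.
    exact: (integrableB measurableT iN ip).
  have -> : e / 2 = \int[Pr l x theta]_w (e / 2) by rewrite (Rintegral_cst1 Pr1).
  rewrite -RintegralD//; apply: le_Rintegral => //.
  - by apply: integrable_norm; exact: (integrableB measurableT iN ip).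
  - exact: (integrableD measurableT ie ia).
  - move=> w _; case: (leP (V (w q).1) d) => Vw.
      rewrite [w q in leLHS]surjective_pairing.
      apply: (le_trans (HN g _ _ ug Vw)); rewrite lerDl.
      by case/andP: ((above_unit d).2 (w q)).
    rewrite /above indicE mem_set//.
    have /andP[f0 f1] := (uf N q).2 w.
    apply: (@le_trans _ _ 1); first by rewrite ler_norml; lra.
    by rewrite lerDr ltW.
rewrite -(subrKA (\int[Pr l x theta]_w frozen Pbar g N (w q))).
rewrite (le_trans (ler_normD _ _))// [e]splitr -addrA.
by rewrite lerD// (le_trans T).
Qed.

Variables (mu : {measure set (X * Theta) -> \bar R})
  (Pxi : probability (path_space (X * Theta)%type) R).
Hypothesis Pxi_law : is_chain_law Pbar mu Pxi.
Variables (s M : R).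
Hypotheses (s_gt0 : 0 < s) (M_ge0 : 0 <= M).
Hypothesis V_average : {ae Pxi, forall w, \forall n \near \oo,
  \sum_(0 <= i < n) V (w i).1 `^ s <= M * n%:R}.

Lemma above_le_powR d z : 0 < d -> above d z <= V z.1 `^ s / d `^ s.
Proof.
move=> d0; rewrite ler_pdivlMr ?powR_gt0// /above indicE.
case: (boolP (_ \in _)) => [|_]; last by rewrite mul0r powR_ge0.
rewrite inE /= => dV; rewrite mul1r ge0_ler_powR ?nnegrE ?ltW//.
exact: lt_trans dV.
Qed.

Lemma above_average d w : 0 < d ->
  (\forall n \near \oo, \sum_(0 <= i < n) V (w i).1 `^ s <= M * n%:R) ->
  \forall n \near \oo, \sum_(0 <= i < n) above d (w i) <= M / d `^ s * n%:R.
Proof.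
move=> d0; apply: filterS => n Hn.
rewrite mulrAC ler_pdivlMr ?powR_gt0//; apply: le_trans Hn.
rewrite mulr_suml; apply: ler_sum => i _.
by rewrite -ler_pdivlMr ?powR_gt0// above_le_powR.
Qed.

Lemma sum_shift_le (a : nat -> R) L n : (forall i, 0 <= a i <= 1) ->
  `| \sum_(0 <= i < n) a (i + L)%N - \sum_(0 <= i < n) a i | <= L%:R.
Proof.
move=> a01; elim: L => [|L IH].
  by under eq_bigr do rewrite addn0; rewrite subrr normr0.
rewrite -(subrKA (\sum_(0 <= i < n) a (i + L)%N)) (le_trans (ler_normD _ _))//.
rewrite -natr1 addrC lerD// -sumrB.
under eq_bigr do rewrite addnS -addSn.
rewrite (telescope_sumr (fun i => a (i + L)%N))// add0n.
have /andP[? ?] := a01 (n + L)%N; have /andP[? ?] := a01 L.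
by rewrite ler_norml; lra.
Qed.

(** A deterministic statement about one path. The six shares of [e] are: one for the shifts by L and
    q, two for the lagged laws of large numbers, one from [close], and two for the frequency of V >
    d, met at time i and again through the expectation at lag q. *)
Lemma unit_lln_path (d e p : R) (q N : nat) (g : X -> R) w :
  unit_fun g -> 0 < d -> 0 < e -> 0 <= p <= 1 -> M / d `^ s <= e ->
  (forall l z, V z.1 <= d ->
    `| transfers Pbar l (q + N) (g \o fst) z - p | <=
    e + transfers Pbar l q (above d) z) ->
  (\forall n \near \oo, \sum_(0 <= i < n) V (w i).1 `^ s <= M * n%:R) ->
  n%:R^-1 * \sum_(0 <= i < n) (g (w (i + (q + N))%N).1 -
    transfers Pbar i (q + N) (g \o fst) (w i)) @[n --> \oo] --> 0 ->
  n%:R^-1 * \sum_(0 <= i < n) (above d (w (i + q)%N) -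
    transfers Pbar i q (above d) (w i)) @[n --> \oo] --> 0 ->
  \forall n \near \oo,
    `| p - n%:R^-1 * \sum_(0 <= i < n) g (w i).1 | <= 6 * e.
Proof.
move=> ug d0 e0 p01 Me close Vw HA HB.
have ugf : unit_fun (g \o fst : X * Theta -> R).
  by case: ug => mg g01; split => [|z]; [exact: measurableT_comp|exact: g01].
set L := (q + N)%N in close HA *.
have [m Lm] : exists m : nat, (L + q)%:R / e <= m%:R.
  by exists (Num.truncn ((L + q)%:R / e)).+1; exact/ltW/truncnS_gt.
move/cvgrPdist_le : HA => /(_ _ e0) HA.
move/cvgrPdist_le : HB => /(_ _ e0) HB.
have HF := above_average d0 Vw.
near=> n.
have n0 : 0 < n%:R :> R by rewrite ltr0n; near: n; exists 1%N.
have norm_le S : `|0 - n%:R^-1 * S| <= e -> `|S| <= e * n%:R.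
  by rewrite sub0r normrN normrM normfV (ger0_norm (ltW n0)) mulrC ler_pdivrMr.
have hA : `| \sum_(0 <= i < n) (g (w (i + L)%N).1 -
    transfers Pbar i L (g \o fst) (w i)) | <= e * n%:R.
  by apply: norm_le; near: n; exact: HA.
have hB : `| \sum_(0 <= i < n) (above d (w (i + q)%N) -
    transfers Pbar i q (above d) (w i)) | <= e * n%:R.
  by apply: norm_le; near: n; exact: HB.
have hF : \sum_(0 <= i < n) above d (w i) <= e * n%:R.
  apply: (@le_trans _ _ (M / d `^ s * n%:R)); first by near: n; exact: HF.
  by rewrite ler_wpM2r// ltW.
have hn : (L + q)%:R <= e * n%:R.
  rewrite mulrC -ler_pdivrMr//; apply: (le_trans Lm).
  by rewrite ler_nat; near: n; exists m.
have sA := @sum_shift_le (fun i => g (w i).1) L n (fun i => ug.2 _).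
have sB := @sum_shift_le (fun i => above d (w i)) q n (fun i => (above_unit d).2 _).
have hU : `| \sum_(0 <= i < n) (transfers Pbar i L (g \o fst) (w i) - p) | <=
    \sum_(0 <= i < n) (e + transfers Pbar i q (above d) (w i) + above d (w i)).
  apply: (le_trans (ler_norm_sum _ _ _)); apply: ler_sum => i _.
  have /andP[? ?] := (transfers_unit Pbar i q (above_unit d)).2 (w i).
  have /andP[? ?] := (transfers_unit Pbar i L ugf).2 (w i).
  case: (leP (V (w i).1) d) => Vd.
    apply: (le_trans (close i _ Vd)); rewrite lerDl.
    by case/andP: ((above_unit d).2 (w i)).
  have -> : above d (w i) = 1 by rewrite /above indicE mem_set.
  by move: p01 => /andP[? ?]; rewrite ler_norml; lra.
have -> : p - n%:R^-1 * \sum_(0 <= i < n) g (w i).1 =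
    (p * n%:R - \sum_(0 <= i < n) g (w i).1) / n%:R by field; rewrite gt_eqF.
rewrite normrM normfV (ger0_norm (ltW n0)) ler_pdivrMr//.
move: hA hB hU sA sB.
rewrite !big_split/= !sumrN !sumr_const_nat subn0 -[e *+ n]mulr_natr -[p *+ n]mulr_natr.
move: hF hn; rewrite natrD.
move: (\sum_(0 <= i < n) above d (w i)) => F.
move: (\sum_(0 <= i < n) g (w i).1) => G.
move: (\sum_(0 <= i < n) g (w (i + L)%N).1) => G'.
move: (\sum_(0 <= i < n) above d (w (i + q)%N)) => F'.
move: (\sum_(0 <= i < n) transfers Pbar i L (g \o fst) (w i)) => S.
move: (\sum_(0 <= i < n) transfers Pbar i q (above d) (w i)) => S'.
rewrite !ler_norml => hF hn /andP[? ?] /andP[? ?] /andP[? ?] /andP[? ?] /andP[? ?].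
by apply/andP; split; lra.
Unshelve. all: by end_near.
Qed.

Lemma unit_lln (g : X -> R) : unit_fun g ->
  {ae Pxi, forall w, n%:R^-1 * \sum_(0 <= i < n) g (w i).1 @[n --> \oo]
    --> \int[pi]_x g x}.
Proof.
move=> ug.
have ugf : unit_fun (g \o fst : X * Theta -> R).
  by case: ug => mg g01; split => [|z]; [exact: measurableT_comp|exact: g01].
set p := \int[pi]_x g x.
have p01 : 0 <= p <= 1 by exact: (unit_fun_Rintegral01 (probability_setT pi) ug).
(* Countably many tolerances, so that the almost sure events can be intersected. *)
pose e k : R := k.+1%:R^-1.
suff H k : {ae Pxi, forall w, \forall n \near \oo,
    `| p - n%:R^-1 * \sum_(0 <= i < n) g (w i).1 | <= 6 * e k}.
  apply: ae_mono (ae_foralln H) => w Hw.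
  apply/cvgrPdist_le => eps eps0.
  have [k ke] : exists k : nat, 6 / eps <= k%:R.
    by exists (Num.truncn (6 / eps)).+1; exact/ltW/truncnS_gt.
  apply: filterS (Hw k) => n /le_trans; apply.
  rewrite /e ler_pdivrMr// mulrC -ler_pdivrMr// (le_trans ke)// ler_nat.
  exact: leqnSn.
have ek0 : 0 < e k by rewrite invr_gt0.
(* Chosen so that d^s = M / e + 1, whence M / d^s <= e; the added 1 keeps d positive when M = 0. *)
pose d := (M / e k + 1) `^ s^-1.
have Mek : 0 <= M / e k by rewrite divr_ge0// ltW.
have d0 : 0 < d by rewrite powR_gt0// ltr_wpDl.
have Md : M / d `^ s <= e k.
  rewrite /d -powRrM mulVf ?gt_eqF// powRr1 ?addr_ge0//.
  rewrite ler_pdivrMr ?ltr_wpDl// mulrDr mulr1 mulrCA mulfV ?gt_eqF// mulr1.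
  by rewrite lerDl ltW.
have [q [N close]] := transfers_close d ek0 ug.
have HA := chain_lln_lag Pxi_law (q + N) (fun=> ugf).
have HB := chain_lln_lag Pxi_law q (fun=> above_unit d).
apply: ae_mono2 HB; last first.
  apply: ae_mono2 HA V_average => w HA HV; exact: (conj HA HV).
move=> w [wA wV] wB.
exact: (unit_lln_path ug d0 ek0 p01 Md close wV wA wB).
Qed.

End adaptive_lln.

(** * Truncation of unbounded functions *)

Section final_lemmas.
Context {R : realType}.
Local Open Scope ring_scope.

Lemma cvg_uniform_approx (a : nat -> R) (ad : nat -> nat -> R) (p : R)
    (pd rd : nat -> R) :
  (forall d, ad d n @[n --> \oo] --> pd d) -> pd d @[d --> \oo] --> p ->
  rd d @[d --> \oo] --> 0 ->
  (forall d, \forall n \near \oo, `|a n - ad d n| <= rd d) ->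
  a n @[n --> \oo] --> p.
Proof.
move=> Had Hpd Hrd Ha; apply/cvgrPdist_le => e e0.
have e3 : 0 < e / 3 by rewrite divr_gt0.
move/cvgrPdist_le : Hpd => /(_ _ e3) Hpd.
move/cvgrPdist_le : Hrd => /(_ _ e3) Hrd.
have [d _ Hdd] := filterI Hpd Hrd.
have [pdd rdd] := Hdd d (leqnn d).
move: (Had d) => /cvgrPdist_le /(_ _ e3) Hd.
near=> n.
have h1 : `|pd d - ad d n| <= e / 3 by near: n; exact: Hd.
have h2 : `|a n - ad d n| <= rd d by near: n; exact: Ha.
move: pdd rdd h1 h2; rewrite sub0r normrN => h0 /ler_normlW hr.
rewrite !ler_norml in h0 *.
move=> /andP[? ?] /andP[? ?]; move: h0 => /andP[? ?]; apply/andP; split; lra.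
Unshelve. all: by end_near.
Qed.

(** The theorem sums from 1 to n, the proof from 0 to n - 1. The two are related by the factor 1 +
    1/n and the single term a_0 / n. *)
Lemma cvg_average_shift (a : nat -> R) (p : R) :
  n%:R^-1 * \sum_(0 <= k < n) a k @[n --> \oo] --> p ->
  n%:R^-1 * \sum_(1 <= k < n.+1) a k @[n --> \oo] --> p.
Proof.
move=> Ha.
have H0 : (n%:R^-1 : R) @[n --> \oo] --> (0 : R).
  by rewrite -cvg_shiftS; exact: cvg_harmonic.
have Ha' : n.+1%:R^-1 * \sum_(0 <= k < n.+1) a k @[n --> \oo] --> p.
  by rewrite (cvg_shiftS (fun n => n%:R^-1 * \sum_(0 <= k < n) a k)).
have H : (1 + n%:R^-1) * (n.+1%:R^-1 * \sum_(0 <= k < n.+1) a k) - n%:R^-1 * a 0%N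
    @[n --> \oo] --> (1 + 0) * p - 0 * a 0%N.
  apply: cvgB; last by apply: cvgM => //; exact: cvg_cst.
  by apply: cvgM => //; apply: cvgD => //; exact: cvg_cst.
rewrite addr0 mul1r mul0r subr0 in H.
apply: cvg_trans H; apply: near_eq_cvg; near=> n.
have n0 : n%:R != 0 :> R by rewrite pnatr_eq0 -lt0n; near: n; exists 1%N.
have n1 : n.+1%:R != 0 :> R by rewrite pnatr_eq0.
rewrite big_ltn//= mulrA.
have -> : (1 + n%:R^-1) / n.+1%:R = n%:R^-1 :> R.
  by rewrite -natr1 in n1 *; field; rewrite n0 n1.
by rewrite mulrDr addrAC subrr add0r.
Unshelve. all: by end_near.
Qed.

End final_lemmas.

(** * Integrability of V^beta under the limit measure *)

Section drift_iterates.
Context {R : realType} {dX : measure_display} {X : measurableType dX}.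
Variables (Q : R.-pker X ~> X) (V : X -> R) (b : R).
Hypotheses (V_meas : measurable_fun setT V) (V_ge1 : forall x, (1 <= V x)%R).
Hypothesis b_ge0 : (0 <= b)%R.
Hypothesis QV : forall x, \int[Q x]_y (V y)%:E <= (V x + b)%:E.

(** Linear growth is enough here: the bound only serves to make V^beta integrable for each
    iterate. *)
Lemma kiter_drift n x : \int[kiter Q n x]_y (V y)%:E <= (V x + b * n%:R)%:E.
Proof.
have mV : measurable_fun setT (EFin \o V) by exact/measurable_EFinP.
have V0 y : (0 <= V y)%R by rewrite (le_trans ler01).
elim: n x => [|n IH] x.
  by rewrite /= /kdirac integral_dirac// diracT mul1e mulr0 addr0.
rewrite [kiter _ _]/= integral_mkcomp_noparam//.
apply: (@le_trans _ _ (\int[Q x]_y ((V y)%:E + (b * n%:R)%:E))).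
  apply: ge0_le_integral => //=.
  - by move=> y _; apply: integral_ge0 => z _; rewrite lee_fin.
  - apply: (measurable_fun_integral_kernel (l := kiter Q n)) => //.
    by move=> U mU; exact: measurable_kernel.
  - by apply: emeasurable_funD.
rewrite ge0_integralD//=; last 2 first.
- by move=> y _; rewrite lee_fin.
- by move=> y _; rewrite lee_fin mulr_ge0.
rewrite integral_cst// prob_kernel mule1.
by rewrite (le_trans (leeD (QV x) (lexx _)))// -EFinD lee_fin -natr1; lra.
Qed.

(* Otherwise V^beta itself, a test function of the norm, would make it +oo. *)
Lemma wnorm_integrable (pi : probability X R) (beta : R) n x :
  (0 <= beta <= 1)%R ->
  wnorm_sub (fun y => V y `^ beta)%R (kiter Q n x) pi < +oo ->
  pi.-integrable setT (EFin \o (fun y => V y `^ beta)%R).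
Proof.
move=> /andP[beta0 beta1] Wlt.
have V0 y : (0 <= V y)%R by rewrite (le_trans ler01).
have mVb : measurable_fun setT (fun y => V y `^ beta)%R.
  exact: (measurableT_comp (measurable_powR beta)).
have mEVb : measurable_fun setT (EFin \o (fun y => V y `^ beta)%R).
  exact/measurable_EFinP.
have Kfin : \int[kiter Q n x]_y (V y `^ beta)%:E \is a fin_num.
  rewrite ge0_fin_numE; last by apply: integral_ge0 => y _; rewrite lee_fin powR_ge0.
  apply: (@le_lt_trans _ _ (V x + b * n%:R)%:E); last exact: ltry.
  apply: le_trans (kiter_drift n x); apply: ge0_le_integral => //=.
  - by move=> y _; rewrite lee_fin powR_ge0.
  - exact/measurable_EFinP.
  - by move=> y _; rewrite lee_fin -[leRHS]powRr1 ?ler_powR.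
apply/integrableP; split => //.
under eq_integral do rewrite /= ger0_norm ?powR_ge0//.
rewrite ltNge leye_eq; apply/negP => /eqP pioo.
have : wnorm_sub (fun y => V y `^ beta)%R (kiter Q n x) pi = +oo.
  apply/eqP; rewrite -leye_eq.
  apply: (@le_trans _ _ (`| \int[kiter Q n x]_y (V y `^ beta)%:E
      - \int[pi]_y (V y `^ beta)%:E |)).
    by rewrite pioo -(fineK Kfin).
  apply: sup_ge0_ub; exists (fun y => V y `^ beta)%R => //=.
  split => // y; rewrite ger0_norm ?powR_ge0// divff// gt_eqF//.
  by rewrite powR_gt0// (lt_le_trans ltr01).
by move=> E; rewrite E ltxx in Wlt.
Qed.

End drift_iterates.

Section bounded_lln.
Context {R : realType} {d d' : measure_display} {T : measurableType d}
  {X : measurableType d'}.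
Variables (Pr : probability T R) (pi : probability X R) (Xn : nat -> T -> X).
Local Open Scope ring_scope.
Hypothesis unit_case : forall g : X -> R, unit_fun g ->
  {ae Pr, forall w, n%:R^-1 * \sum_(0 <= i < n) g (Xn i w) @[n --> \oo]
    --> \int[pi]_x g x}.

Lemma bounded_lln (h : X -> R) (B : R) : measurable_fun setT h ->
  0 < B -> (forall x, `|h x| <= B) ->
  {ae Pr, forall w, n%:R^-1 * \sum_(0 <= i < n) h (Xn i w) @[n --> \oo]
    --> \int[pi]_x h x}.
Proof.
move=> mh B0 hB.
pose g x := (2 * B)^-1 * (h x + B).
have BB0 : 0 < 2 * B by rewrite mulr_gt0.
have hE x : h x = 2 * B * g x - B by rewrite /g mulrA mulfV ?gt_eqF// mul1r addrK.
have ug : unit_fun g.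
  split; first by apply: measurable_funM => //; exact: measurable_funD.
  move=> x; have := hB x; rewrite ler_norml => /andP[? ?].
  rewrite /g mulrC divr_ge0 ?(ltW BB0)//=; last by lra.
  by rewrite ler_pdivrMr// mul1r; lra.
have pi1 : pi setT = 1%E by exact: probability_setT.
have -> : \int[pi]_x h x = 2 * B * \int[pi]_x g x - B * 1.
  have ig := unit_fun_integrable pi1 ug.
  rewrite mulr1 -[X in _ - X](Rintegral_cst1 pi1) -RintegralZl// -RintegralB//.
  - by apply: eq_Rintegral => x _; exact: hE.
  - exact: (integrableZl measurableT (2 * B) ig).
  - by apply: (bounded_integrable (B := `|B|)).
apply: ae_mono (unit_case ug) => w Hw.
(* Writing n^-1 * n instead of 1 makes the identity with the averages of [h] valid for every n,
   including n = 0, where the inverse is 0. *)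
have : 2 * B * (n%:R^-1 * \sum_(0 <= i < n) g (Xn i w)) - B * (n%:R^-1 * n%:R)
    @[n --> \oo] --> 2 * B * \int[pi]_x g x - B * 1.
  apply: cvgB; apply: cvgM => //; try exact: cvg_cst.
  have H : cst (1 : R) n @[n --> \oo] --> (1 : R) by exact: cvg_cst.
  apply: cvg_trans H; apply: near_eq_cvg; near=> n.
  rewrite mulVf// pnatr_eq0 -lt0n; near: n; by exists 1%N.
apply: cvg_trans; apply: near_eq_cvg; apply: nearW => n.
rewrite mulrCA [B * _]mulrCA -mulrBr; congr (_ * _).
under [in RHS]eq_bigr do rewrite hE.
by rewrite sumrB sumr_const_nat subn0 mulr_sumr mulr_natr.
Unshelve. all: by end_near.
Qed.

End bounded_lln.

Section truncation.
Context {R : realType} {d d' : measure_display} {T : measurableType d}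
  {X : measurableType d'}.
Variables (Pr : probability T R) (pi : probability X R) (Xn : nat -> T -> X).
Local Open Scope ring_scope.
Hypothesis unit_case : forall g : X -> R, unit_fun g ->
  {ae Pr, forall w, n%:R^-1 * \sum_(0 <= i < n) g (Xn i w) @[n --> \oo]
    --> \int[pi]_x g x}.
Variables (V f : X -> R) (beta s M C : R).
Hypotheses (V_meas : measurable_fun setT V) (V_ge1 : forall x, 1 <= V x).
Hypotheses (beta0 : 0 <= beta) (betas : beta < s) (M0 : 0 < M).
Hypotheses (f_meas : measurable_fun setT f)
  (fM : forall x, `|f x| <= M * V x `^ beta).
Hypothesis pi_V : pi.-integrable setT (EFin \o (fun x => V x `^ beta)).
Hypothesis V_average : {ae Pr, forall w, \forall n \near \oo,
  \sum_(0 <= i < n) V (Xn i w) `^ s <= C * n%:R}.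

Let t := s - beta.

Let t_gt0 : 0 < t.
Proof. by rewrite subr_gt0. Qed.

Let Vpos x : 0 < V x.
Proof. exact: lt_le_trans (V_ge1 x). Qed.

(** Truncating according to V^t, with t = s - beta, gives V^beta <= V^s / (k + 1) wherever f is cut
    off. *)
Definition truncated (k : nat) (x : X) : R :=
  if V x `^ t <= k.+1%:R then f x else 0.

Lemma measurable_truncated k : measurable_fun setT (truncated k).
Proof.
apply: measurable_fun_ifT => //.
by apply: measurable_fun_ler => //; exact: (measurableT_comp (measurable_powR t)).
Qed.

Lemma truncated_bound k x : `|truncated k x| <= M * k.+1%:R `^ (beta / t).
Proof.
rewrite /truncated; case: ifPn => [Vk|_]; last first.
  by rewrite normr0 mulr_ge0 ?powR_ge0// ltW.
rewrite (le_trans (fM x))// ler_wpM2l ?(ltW M0)//.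
have -> : V x `^ beta = (V x `^ t) `^ (beta / t).
  by rewrite -powRrM mulrC divfK// gt_eqF.
by rewrite ge0_ler_powR ?nnegrE ?powR_ge0// divr_ge0// ltW.
Qed.

Lemma truncated_diff k x : `|f x - truncated k x| <= M * (V x `^ s / k.+1%:R).
Proof.
rewrite /truncated; case: ifPn => [_|].
  by rewrite subrr normr0 mulr_ge0 ?divr_ge0 ?powR_ge0// ltW.
rewrite -ltNge subr0 => Vk; rewrite (le_trans (fM x))// ler_wpM2l ?(ltW M0)//.
rewrite ler_pdivlMr// (_ : V x `^ s = V x `^ beta * V x `^ t).
  by rewrite ler_wpM2l ?powR_ge0// ltW.
by rewrite -powRD ?(gt_eqF (Vpos x)) ?implybT// /t subrKC.
Qed.

Lemma powR_dominated_integrable : pi.-integrable setT (EFin \o f).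
Proof.
have ig : pi.-integrable setT (EFin \o (fun x => M * V x `^ beta)).
  exact: (integrableZl measurableT M pi_V).
apply: le_integrable ig => //; first exact/measurable_EFinP.
move=> x _ /=; rewrite lee_fin [leRHS]ger0_norm//.
by rewrite mulr_ge0 ?powR_ge0// ltW.
Qed.

Lemma truncated_integral_cvg :
  \int[pi]_x truncated k x @[k --> \oo] --> \int[pi]_x f x.
Proof.
have ig : pi.-integrable setT (EFin \o (fun x => M * V x `^ beta)).
  exact: (integrableZl measurableT M pi_V).
have if_ := powR_dominated_integrable.
have H := @dominated_cvg _ X R pi setT measurableT (fun k => EFin \o truncated k)
  (EFin \o f) (EFin \o (fun x => M * V x `^ beta)).
have : (\int[pi]_x (truncated k x)%:E @[k --> \oo] --> \int[pi]_x (f x)%:E)%E.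
  apply: H => //.
  - by move=> k; apply/measurable_EFinP; exact: measurable_truncated.
  - move=> x _; apply: cvg_EFin; first exact: nearW.
    have H : cst (f x) k @[k --> \oo] --> f x by exact: cvg_cst.
    have [m Vm] : exists m : nat, V x `^ t <= m%:R.
      by exists (Num.truncn (V x `^ t)).+1; exact/ltW/truncnS_gt.
    apply: cvg_trans H; apply: near_eq_cvg; near=> k.
    rewrite /= /truncated ifT// (le_trans Vm)// ler_nat.
    have : (m <= k)%N by near: k; exists m.
    exact: leqW.
  - move=> k x _ /=; rewrite lee_fin /truncated.
    case: ifPn => _; first exact: fM.
    by rewrite normr0 mulr_ge0 ?powR_ge0// ltW.
move=> H2.
have -> : \int[pi]_x f x = fine (\int[pi]_x (f x)%:E)%E by [].
apply: fine_cvg; rewrite fineK//.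
exact: integrable_fin_num.
Unshelve. all: by end_near.
Qed.

(** The bound on the averages of V^s controls the truncation error by M C / (k + 1) for all large n,
    which allows the limits in n and k to be combined. *)
Lemma truncation_lln :
  {ae Pr, forall w, n%:R^-1 * \sum_(0 <= i < n) f (Xn i w) @[n --> \oo]
    --> \int[pi]_x f x}.
Proof.
have B0 k : 0 < M * k.+1%:R `^ (beta / t) by rewrite mulr_gt0// powR_gt0.
have Hk k := bounded_lln unit_case (measurable_truncated k) (B0 k)
  (truncated_bound k).
apply: ae_mono2 (ae_foralln Hk) V_average => w Hw HV.
apply: (cvg_uniform_approx (pd := fun k => \int[pi]_x truncated k x)
  (rd := fun k => M * C * k.+1%:R^-1) Hw).
- exact: truncated_integral_cvg.
- rewrite -[X in _ --> X](mulr0 (M * C)); apply: cvgM; first exact: cvg_cst.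
  exact: cvg_harmonic.
- move=> k; near=> n.
  have n0 : 0 < n%:R :> R by rewrite ltr0n; near: n; exists 1%N.
  rewrite -mulrBr -sumrB normrM normfV (ger0_norm (ltW n0)) mulrC ler_pdivrMr//.
  apply: (le_trans (ler_norm_sum _ _ _)).
  apply: (@le_trans _ _ (\sum_(0 <= i < n) M * (V (Xn i w) `^ s / k.+1%:R))).
    by apply: ler_sum => i _; exact: truncated_diff.
  rewrite -mulr_sumr -mulr_suml -!mulrA ler_wpM2l ?(ltW M0)//.
  rewrite [leRHS]mulrA [leRHS]mulrAC ler_wpM2r ?invr_ge0//.
  by near: n; exact: HV.
Unshelve. all: by end_near.
Qed.

End truncation.

Lemma integral_product_fst {R : realType} d d' (X : measurableType d)
  (Y : measurableType d') (xi1 : probability X R) (xi2 : probability Y R)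
  (g : X -> \bar R) : measurable_fun setT g -> (forall x, 0 <= g x) ->
  \int[xi1 \x xi2]_z g z.1 = \int[xi1]_x g x.
Proof.
move=> mg g0.
transitivity (\int[pushforward (xi1 \x xi2) fst]_x g x).
  by rewrite ge0_integral_pushforward// preimage_setT.
apply: eq_measure_integral => A mA _.
rewrite -[LHS]/((xi1 \x xi2) (fst @^-1` A)).
have -> : fst @^-1` A = A `*` [set: Y] by apply/seteqP; split => [z|z []].
by rewrite product_measure1E// [X in _ * X]probability_setT mule1.
Qed.

Theorem theorem2p5 (R : realType)
  (dX dT : measure_display) (X : measurableType dX) (Theta : measurableType dT)
  (X_cg : countably_generated X) (Theta_cg : countably_generated Theta)
  (P : Theta -> R.-pker X ~> X)
  (P_meas : forall (x : X) (A : set X), measurable A ->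
    measurable_fun setT (fun theta => P theta x A : \bar R))
  (Pbar : nat -> R.-pker (X * Theta)%type ~> (X * Theta)%type)
  (Pbar_P : forall (n : nat) (x : X) (theta : Theta) (A : set X),
    measurable A -> Pbar n (x, theta) (A `*` setT) = P theta x A)
  (Pr : nat -> X -> Theta -> probability (path_space (X * Theta)%type) R)
  (Pr_law : forall (l : nat) (x : X) (theta : Theta),
    is_chain_law (fun n => Pbar (l + n)%N) \d_((x, theta)) (Pr l x theta))
  (nu : probability X R) (eps : R) (C : set X)
  (eps_gt0 : (0 < eps)%R) (C_meas : measurable C)
  (minorization : forall (theta : Theta) (x : X) (A : set X), measurable A ->
    (\1_C x * eps)%:E * nu A <= P theta x A)
  (V : X -> R) (alpha b c : R)
  (V_meas : measurable_fun setT V) (V_ge1 : forall x, (1 <= V x)%R)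
  (alpha_gt0 : (0 < alpha)%R) (alpha_lt1 : (alpha < 1)%R)
  (b_gt0 : (0 < b)%R) (c_gt0 : (0 < c)%R)
  (drift : forall (theta : Theta) (x : X),
    \int[P theta x]_y (V y)%:E
      <= (V x - c * V x `^ (1 - alpha) + b * \1_C x)%:E)
  (pi : probability X R) (beta : R)
  (beta_ge0 : (0 <= beta)%R) (beta_lt : (beta < 1 - alpha)%R)
  (ergodicity : forall d : R,
    sup_ge0 [set wnorm_sub (fun y => V y `^ beta)%R (kiter (P theta) n x) pi
             | x in [set x | (V x <= d)%R] & theta in [set: Theta]]
      @[n --> \oo] --> 0)
  (diminishing : forall (d e : R), (0 < e)%R ->
    sup_ge0 (\bigcup_l
      [set outer_prob (Pr l x theta)
             [set w | e%:E <= kernel_dist P (w n).2 (w n.-1).2]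
       | x in [set x | (V x <= d)%R] & theta in [set: Theta]])
      @[n --> \oo] --> 0)
  (f : X -> R) (f_meas : measurable_fun setT f)
  (f_bounded : sup_ge0 [set (`|f x| / V x `^ beta)%:E | x in [set: X]] < +oo)
  (xi1 : probability X R) (xi2 : probability Theta R)
  (xi1V : \int[xi1]_x (V x)%:E < +oo)
  (Pxi : probability (path_space (X * Theta)%type) R)
  (Pxi_law : is_chain_law Pbar (xi1 \x xi2) Pxi) :
  {ae Pxi, forall w,
    (n%:R^-1 * \sum_(1 <= k < n.+1) f (w k).1)%:E @[n --> \oo]
      --> \int[pi]_x (f x)%:E}.
Proof.
(* The midpoint of beta and 1 - alpha: above beta for the truncation, below 1 - alpha so that s +
   alpha < 1. *)
pose s : R := ((beta + (1 - alpha)) / 2)%R.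
have beta_s : (beta < s)%R by rewrite /s; lra.
have s_lt : (s < 1 - alpha)%R by rewrite /s; lra.
have s_gt0 : (0 < s)%R by lra.
have b_ge0 := ltW b_gt0.
have V0 x : (0 <= V x)%R by rewrite (le_trans ler01).
have EV_meas : measurable_fun setT (EFin \o V) by exact/measurable_EFinP.
have bC x : (b * \1_C x <= b)%R.
  by rewrite ler_piMr// indicE; case: (x \in C).
have PV theta x : \int[P theta x]_y (V y)%:E <= (V x + b)%:E.
  apply: (le_trans (drift theta x)); rewrite lee_fin lerD// gerBl.
  by rewrite mulr_ge0 ?powR_ge0// ltW.
have chain_drift n (z : X * Theta) : \int[Pbar n z]_y (V y.1)%:E <=
    (V z.1 - c * V z.1 `^ (1 - alpha) + b)%:E.
  rewrite (integral_Pbar_fst Pbar_P n z (g := EFin \o V))//.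
  by apply: (le_trans (drift z.2 z.1)); rewrite lee_fin lerD2l.
pose m := fine (\int[xi1]_x (V x)%:E).
have m_ge0 : (0 <= m)%R by apply: fine_ge0; apply: integral_ge0 => x _; rewrite lee_fin.
have chain_start : \int[xi1 \x xi2]_z (V z.1)%:E <= m%:E.
  rewrite (integral_product_fst xi1 xi2 (g := EFin \o V))//.
  rewrite /m fineK// ge0_fin_numE//.
  by apply: integral_ge0 => x _; rewrite lee_fin.
have mVfst : measurable_fun setT (fun z : X * Theta => V z.1).
  exact: measurableT_comp.
pose C0 : R := (2 * (2 * (b + 1) / c))%R.
have C0_ge0 : (0 <= C0)%R by rewrite /C0 !mulr_ge0 ?invr_ge0 ?addr_ge0// ltW.
have V_average : {ae Pxi, forall w, \forall n \near \oo,
    (\sum_(0 <= i < n) V (w i).1 `^ s <= C0 * n%:R)%R}.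
  exact: (power_sum_bound Pxi_law mVfst (fun z => V_ge1 z.1) b_ge0 c_gt0 m_ge0
    (ltW s_gt0) alpha_gt0 s_lt chain_drift chain_start).
have unit_case g : unit_fun g -> {ae Pxi, forall w,
    (n%:R^-1 * \sum_(0 <= i < n) g (w i).1)%R @[n --> \oo]
    --> (\int[pi]_x g x)%R}.
  exact: (unit_lln Pbar_P Pr_law V_meas V_ge1 beta_ge0 ergodicity diminishing
    Pxi_law s_gt0 C0_ge0 V_average).
have pi_V : pi.-integrable setT (EFin \o (fun x => V x `^ beta)%R).
  (* A finite norm at one state, one parameter and one time suffices; [point] supplies the first
     two, and the level [V point] makes its level set contain that state. *)
  have [N _ HN] := cvge0_lt ltr01 (ergodicity (V point)).
  apply: (@wnorm_integrable _ _ _ (P point) V b V_meas V_ge1 b_ge0 (PV point)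
    pi beta N point).
    by rewrite beta_ge0/=; lra.
  apply: le_lt_trans (lt_trans (HN N (leqnn N)) (ltry 1)).
  apply: sup_ge0_ub; exists point => //=.
  by exists point.
pose sf := sup_ge0 [set (`|f x| / V x `^ beta)%:E | x in [set: X]].
(* Adding 1 keeps the constant positive even when f vanishes, as the rescaling of bounded functions
   requires. *)
pose M : R := (fine sf + 1)%R.
have sf_fin : sf \is a fin_num by rewrite ge0_fin_numE ?sup_ge0_ge0.
have sf0 : (0 <= fine sf)%R by apply: fine_ge0; exact: sup_ge0_ge0.
have M_gt0 : (0 < M)%R by rewrite /M; lra.
have fM x : (`|f x| <= M * V x `^ beta)%R.
  have Vb : (0 < V x `^ beta)%R by rewrite powR_gt0// (lt_le_trans ltr01).
  rewrite -ler_pdivrMr//; apply: (@le_trans _ _ (fine sf)); last by rewrite lerDl.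
  by rewrite -lee_fin fineK//; apply: sup_ge0_ub; exists x.
have := truncation_lln (Xn := fun i (w : path_space (X * Theta)%type) => (w i).1)
  unit_case V_meas V_ge1 beta_ge0 beta_s M_gt0 f_meas fM pi_V V_average.
apply: ae_mono => w Hw.
have f_int := powR_dominated_integrable M_gt0 f_meas fM pi_V.
have -> : \int[pi]_x (f x)%:E = ((\int[pi]_x f x)%R)%:E.
  by rewrite fineK//; exact: integrable_fin_num.
apply: cvg_EFin; first exact: nearW.
exact: (cvg_average_shift Hw).
Qed.
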